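(* Let $n\ge 2$ and let the set of gladiators $[n]=\{1,\dots,n\}$ be partitioned into teams $T_1,\dots,T_k$, with team strengths $s_1,\dots,s_k>0$. Let $\mathcal{G}_k(n)$ be the corresponding gladiator chain on $S_n$ and $\mathcal{X}_k(n)$ the corresponding linear particle system (with $n_j=|T_j|$ particles of type $j$ and strength $s_j$). Then $t(\mathcal{G}_k(n))\le O(n^8)\, t(\mathcal{X}_k(n))$.
   Context: Gladiator $g$ has strength $s(g)=s_j$ iff $g\in T_j$. A permutation $\sigma\in S_n$ is viewed as an arrangement of gladiators in positions $1,\dots,n$, $\sigma(i)$ being the gladiator at position $i$. The gladiator chain $\mathcal{G}_k(n)$: from state $\sigma$, choose $i\in\{1,\dots,n-1\}$ uniformly at random; with $g=\sigma(i)$, $g'=\sigma(i+1)$, place $g$ at position $i+1$ and $g'$ at position $i$ with probability $s(g)/(s(g)+s(g'))$, and otherwise place $g'$ at position $i+1$ and $g$ at position $i$. Its stationary distribution is $\pi(\sigma)\propto\prod_{i=1}^n s(\sigma(i))^{i}$. The linear particle system $\mathcal{X}_k(n)$ is the Markov chain on the set of all linear arrangements of $n_j$ indistinguishable particles of type $j$ ($j=1,\dots,k$) obtained by regarding gladiators of the same team as indistinguishable: choose $i\in\{1,\dots,n-1\}$ uniformly; if the particles at $i,i+1$ have the same type do nothing; if they have types $t\neq t'$, place the type-$t$ particle at position $i+1$ with probability $s_t/(s_t+s_{t'})$ and at position $i$ otherwise. For a chain $\mathcal{M}$ with stationary distribution $\pi$, the mixing time $t(\mathcal{M})$ is the least $t$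 with $\max_x\|P^t(x,\cdot)-\pi\|_{TV}\le1/4$. *)

(* Defs.v *)
From HB Require Import structures.
From mathcomp Require Import all_boot all_order all_algebra all_fingroup.
From mathcomp Require Import all_classical all_reals ereal.

Set Implicit Arguments.
Unset Strict Implicit.
Unset Printing Implicit Defensive.

Import Order.TTheory GRing.Theory Num.Theory.

Local Open Scope ring_scope.

Section FiniteChains.
Variables (R : realType) (T : finType).
Implicit Types (P : T -> T -> R) (p q pi : T -> R).

Definition is_distribution p : Prop :=
  (forall x, 0 <= p x) /\ \sum_x p x = 1.

Definition stationary P pi : Prop :=
  is_distribution pi /\ forall y, \sum_x pi x * P x y = pi y.

Fixpoint chain_pow P (t : nat) (x y : T) : R :=
  if t is t'.+1 then \sum_z P x z * chain_pow P t' z y else (x == y)%:R.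

Definition tv_dist p q : R := 2^-1 * \sum_x `|p x - q x|.

Definition mixed P pi (t : nat) : Prop :=
  forall x, tv_dist (chain_pow P t x) pi <= 4^-1.

(* The least t is taken over the positive integers: this only matters for
   one-state chains, whose mixing time is then 1 instead of 0.  An infimum of
   natural numbers is attained; the value is +oo if the chain never mixes. *)
Definition mixing_time P pi : \bar R :=
  ereal_inf [set (t%:R)%:E | t in [set t : nat | (0 < t)%N /\ mixed P pi t]]%classic.

(* Transition probability to z of the step "from x, go to y with probability
   a, and stay at x otherwise"; y may be equal to x. *)
Definition move_or_stay (a : R) (x y z : T) : R :=
  a * (z == y)%:R + (1 - a) * (z == x)%:R.

End FiniteChains.

(* Average of the quantity F i i' over the n.-1 pairs (i, i') of adjacent
   positions i' = i + 1.  Positions 1..n are the ordinals 0..n-1. *)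
Definition adjacent_mean (R : realType) (n : nat) (F : 'I_n -> 'I_n -> R) : R :=
  (n.-1)%:R^-1 *
  \sum_(i < n) \sum_(i' < n | i' == i.+1 :> nat) F i i'.

Section Gladiators.
(* The teams are the fibres T_j of team; the gladiators are the elements of
   'I_n and s j is the strength of team j. *)
Variables (R : realType) (n k : nat) (team : 'I_n -> 'I_k) (s : 'I_k -> R).

Definition team_set (j : 'I_k) : {set 'I_n} := [set g | team g == j].

Definition strength (g : 'I_n) : R := s (team g).

(* sigma p is the gladiator at position p.  Since (t * sigma) p = sigma (t p),
   tperm i i' * sigma is sigma with the contents of positions i and i'
   exchanged. *)
Definition gladiator_chain (sigma sigma' : {perm 'I_n}) : R :=
  adjacent_mean (fun i i' =>
    let g := sigma i in let g' := sigma i' in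
    move_or_stay (strength g / (strength g + strength g'))
      sigma (tperm i i' * sigma)%g sigma').

Definition arrangement_of (m : 'I_k -> nat) : pred {ffun 'I_n -> 'I_k} :=
  fun x => [forall j, #|[set p | x p == j]| == m j].

(* x p is the type of the particle at position p; there are #|T_j| particles
   of type j. *)
Definition particle_state :=
  {x : {ffun 'I_n -> 'I_k} | arrangement_of (fun j => #|team_set j|) x}.
HB.instance Definition _ := Finite.on particle_state.

Definition exchange (x : {ffun 'I_n -> 'I_k}) (i i' : 'I_n) :
  {ffun 'I_n -> 'I_k} := [ffun p => x (tperm i i' p)].

Definition linear_particle_system (x x' : particle_state) : R :=
  adjacent_mean (fun i i' =>
    let t := val x i in let t' := val x i' in
    if t == t' then (x' == x)%:R
    else move_or_stay (s t / (s t + s t'))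
           (val x) (exchange (val x) i i') (val x')).

End Gladiators.

Arguments linear_particle_system {R n k} team s x x'.

(* Main.v *)
(* Write c(p) for the number of particles of type j among the first p positions.
   For a gladiator g of T_j, let H(sigma, p) count the gladiators g' <= g of T_j
   among the first p positions.  Couple two copies of the gladiator chain with
   the same arrangement of types so that a selected pair of team-mates is put in
   the same relative order, increasing or decreasing, in both copies.  Then the
   difference of the two H's, as a function of the rank c(p), is replaced on
   average at the rank r of a selected pair by at most the mean of its values at
   r - 1 and r + 1.  The expected difference is therefore dominated by a profile
   D on {0, ..., |T_j|} undergoing local averaging along the trajectory of the
   particle system.  If D is initially concave and vanishes at both ends, it
   stays so and decreases pointwise; its mass contracts by a factor 1 - n^-5/4
   during any period after which consecutive particles of type j are adjacent
   with probability at least 1/(2 n^2).  Under the stationary measure (weights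
   prod_p s(x_p)^p) they are adjacent with probability at least 1/n^2, because
   they can be brought together by two exchanges that increase the weight; hence
   O(n) mixing times of the particle system suffice for such a period, and O(n^6)
   periods make the discrepancy negligible. *)
Require Import Defs.
From HB Require Import structures.
From mathcomp Require Import all_boot all_order all_algebra all_fingroup.
From mathcomp Require Import all_classical all_reals ereal.
From mathcomp Require Import lra ring zify.

Set Implicit Arguments.
Unset Strict Implicit.
Unset Printing Implicit Defensive.

Import Order.TTheory GRing.Theory Num.Theory.
Local Open Scope ring_scope.

(** * Finite chains as operators *)

Section ChainOperator.
Variables (R : realType) (T : finType).
Implicit Types (P : T -> T -> R) (f phi mu : T -> R).

Definition chain_op P f (x : T) : R := \sum_y P x y * f y.

Lemma chain_op_iter P t f x :
  iter t (chain_op P) f x = \sum_y chain_pow P t x y * f y.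
Proof.
elim: t x => [|t IHt] x /=.
  rewrite (bigD1 x) //= eqxx mul1r big1 ?addr0 // => y /negbTE.
  by rewrite eq_sym => ->; rewrite mul0r.
rewrite {1}/chain_op; under [LHS]eq_bigr do rewrite IHt mulr_sumr.
rewrite exchange_big /=; apply: eq_bigr => y _.
by rewrite mulr_suml; apply: eq_bigr => z _; rewrite mulrA.
Qed.

(** The difference between the row and [pi] has total mass zero, so [f] may be replaced by [f - c];
    a [tv_dist] of [4^-1] is an l^1 distance of [2^-1], whence the halving. *)
Lemma chain_op_iter_center P pi t f c B x : is_distribution pi ->
  tv_dist (chain_pow P t x) pi <= 4^-1 -> (forall y, `|f y - c| <= B) ->
  \sum_y chain_pow P t x y = 1 ->
  `|iter t (chain_op P) f x - \sum_y pi y * f y| <= B / 2.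
Proof.
move=> [_ pi1] tvP fB row1; rewrite chain_op_iter -sumrB.
have -> : \sum_y (chain_pow P t x y * f y - pi y * f y) =
          \sum_y (chain_pow P t x y - pi y) * (f y - c).
  rewrite -[LHS](addr0) -[X in _ + X](_ : - (c * (1 - 1)) = 0); last first.
    by rewrite subrr mulr0 oppr0.
  rewrite -{1}row1 -pi1 -sumrB mulr_sumr -sumrN -big_split /=.
  by apply: eq_bigr => y _; ring.
apply: le_trans (ler_norm_sum _ _ _) _.
apply: (@le_trans _ _ (\sum_y `|chain_pow P t x y - pi y| * B)).
  by apply: ler_sum => y _; rewrite normrM ler_wpM2l.
rewrite -mulr_suml mulrC ler_wpM2l ?(le_trans _ (fB x)) //.
by move: tvP; rewrite /tv_dist; lra.
Qed.

Lemma chain_pow_row_sum P t x :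
  (forall y, \sum_z P y z = 1) -> \sum_y chain_pow P t x y = 1.
Proof.
move=> P1; elim: t x => [|t IHt] x /=.
  by rewrite (bigD1 x) //= eqxx big1 ?addr0 // => y /negbTE; rewrite eq_sym => ->.
rewrite exchange_big /= -[RHS](P1 x); apply: eq_bigr => z _.
by rewrite -mulr_sumr IHt mulr1.
Qed.

(** Each block of [t] steps halves the deviation; the centre for the next block is the [pi]-mean of
    the function reached so far. *)
Lemma mixed_contraction P pi t f :
    is_distribution pi -> (forall y, \sum_z P y z = 1) -> mixed P pi t ->
    (forall y, `|f y| <= 1) ->
  forall c, exists b, forall x, `|iter (c * t) (chain_op P) f x - b| <= 2^-1 ^+ c.
Proof.
move=> pid P1 mixP f1; elim=> [|c [b IHc]].
  by exists 0 => x; rewrite mul0n /= subr0 expr0.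
exists (\sum_y pi y * iter (c * t) (chain_op P) f y) => x.
rewrite mulSn iterD exprSr.
exact: (chain_op_iter_center pid (mixP x) IHc (chain_pow_row_sum t x P1)).
Qed.

Lemma invariant_iter P mu t f :
  (forall f, \sum_x mu x * chain_op P f x = \sum_x mu x * f x) ->
  \sum_x mu x * iter t (chain_op P) f x = \sum_x mu x * f x.
Proof. by move=> inv; elim: t => //= t IHt; rewrite inv. Qed.

Lemma stationary_invariant P pi f : stationary P pi ->
  \sum_x pi x * chain_op P f x = \sum_x pi x * f x.
Proof.
case=> _ piP; under eq_bigr do rewrite /chain_op mulr_sumr.
rewrite exchange_big /=; apply: eq_bigr => y _; rewrite -[in RHS]piP mulr_suml.
by apply: eq_bigr => x _; rewrite mulrA.
Qed.

Lemma distribution_mean_close mu f c B : is_distribution mu ->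
  (forall x, `|f x - c| <= B) -> `|\sum_x mu x * f x - c| <= B.
Proof.
case=> mu0 mu1 fB.
have -> : \sum_x mu x * f x - c = \sum_x mu x * (f x - c).
  rewrite -{1}[c]mul1r -mu1 mulr_suml -sumrB.
  by apply: eq_bigr => x _; rewrite mulrBr.
apply: le_trans (ler_norm_sum _ _ _) _.
apply: (@le_trans _ _ (\sum_x mu x * B)).
  by apply: ler_sum => x _; rewrite normrM ger0_norm // ler_wpM2l.
by rewrite -mulr_suml mu1 mul1r.
Qed.

(** Total variation is tested by functions with values in [-1, 1]. By stationarity the [pi]-mean of
    [f] is that of its iterate, hence within the oscillation of the value at any state. *)
Lemma mixed_of_oscillation P pi t : stationary P pi ->
  (forall f, (forall x, `|f x| <= 1) -> forall x y,
     `|iter t (chain_op P) f x - iter t (chain_op P) f y| <= 2^-1) ->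
  mixed P pi t.
Proof.
move=> piP osc x; rewrite /tv_dist.
(* The sign of the difference is the test function that attains the l^1 distance. *)
pose f y := Num.sg (chain_pow P t x y - pi y).
have f1 y : `|f y| <= 1 by rewrite /f normr_sg lern1; case: eqP.
have -> : \sum_y `|chain_pow P t x y - pi y| =
          iter t (chain_op P) f x - \sum_y pi y * f y.
  rewrite chain_op_iter -sumrB; apply: eq_bigr => y _.
  by rewrite normrEsg /f; ring.
rewrite -(invariant_iter t f (fun f => stationary_invariant f piP)).
have := distribution_mean_close piP.1 (fun y => osc f f1 y x).
by rewrite ler_distl => /andP[H1 H2]; lra.
Qed.

End ChainOperator.

(** * Averages over the pairs of adjacent positions *)

Section AdjacentMean.
Variables (R : realType) (n : nat).
Implicit Types F E : 'I_n -> 'I_n -> R.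
Local Notation AM := (@adjacent_mean R n).

Lemma eq_adjacent_mean F E :
  (forall i i' : 'I_n, i' = i.+1 :> nat -> F i i' = E i i') -> AM F = AM E.
Proof.
move=> FE; congr (_ * _); apply: eq_bigr => i _; apply: eq_bigr => i' /eqP.
exact: FE.
Qed.

Lemma le_adjacent_mean F E :
  (forall i i' : 'I_n, i' = i.+1 :> nat -> F i i' <= E i i') -> AM F <= AM E.
Proof.
move=> FE; rewrite ler_wpM2l ?invr_ge0 ?ler0n //.
by apply: ler_sum => i _; apply: ler_sum => i' /eqP; exact: FE.
Qed.

Lemma adjacent_meanD F E : AM (fun i i' => F i i' + E i i') = AM F + AM E.
Proof.
rewrite /adjacent_mean -mulrDr -big_split /=; congr (_ * _).
by apply: eq_bigr => i _; rewrite -big_split.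
Qed.

Lemma adjacent_meanZ a F : AM (fun i i' => a * F i i') = a * AM F.
Proof.
rewrite /adjacent_mean mulrCA; congr (_ * _); rewrite mulr_sumr.
by apply: eq_bigr => i _; rewrite mulr_sumr.
Qed.

Lemma adjacent_mean_sum (J : Type) (r : seq J) (Q : pred J)
    (F : J -> 'I_n -> 'I_n -> R) :
  AM (fun i i' => \sum_(j <- r | Q j) F j i i') = \sum_(j <- r | Q j) AM (F j).
Proof.
rewrite /adjacent_mean -mulr_sumr; congr (_ * _).
rewrite [RHS]exchange_big /=; apply: eq_bigr => i _.
by rewrite [RHS]exchange_big.
Qed.

Lemma norm_adjacent_mean F : `|AM F| <= AM (fun i i' => `|F i i'|).
Proof.
rewrite /adjacent_mean normrM ger0_norm ?ler_wpM2l ?invr_ge0 ?ler0n //.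
apply: le_trans (ler_norm_sum _ _ _) _; apply: ler_sum => i _.
exact: ler_norm_sum.
Qed.

Lemma adjacent_mean_dist_le F E (B : 'I_n -> 'I_n -> R) :
  (forall i i' : 'I_n, i' = i.+1 :> nat -> `|F i i' - E i i'| <= B i i') ->
  `|AM F - AM E| <= AM B.
Proof.
move=> FEB; rewrite -mulN1r -adjacent_meanZ -adjacent_meanD.
apply: le_trans (norm_adjacent_mean _) _; apply: le_adjacent_mean => i i' ii'.
by rewrite mulN1r; apply: FEB.
Qed.

Lemma adjacent_mean_cst (c : R) : (2 <= n)%N -> AM (fun _ _ => c) = c.
Proof.
move=> n2; rewrite /adjacent_mean; apply: (mulfI (_ : n.-1%:R != 0)).
  by rewrite pnatr_eq0; lia.
rewrite mulrA mulfV ?mul1r; last by rewrite pnatr_eq0; lia.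
(* The last position has no right neighbour, which leaves [m] terms. *)
case: n n2 => [//|m] _ /=; rewrite big_ord_recr /= [X in _ + X]big_pred0 ?addr0; last first.
  by move=> i; apply: ltn_eqF; exact: ltn_ord.
rewrite (eq_bigr (fun _ => c)) => [|i _].
  by rewrite sumr_const card_ord mulr_natl.
by rewrite (big_pred1 (lift ord0 i)).
Qed.

End AdjacentMean.

(** * Prefix counts and concave profiles *)

Section PrefixCount.
Variable n : nat.
Implicit Types (b : pred 'I_n) (i q : 'I_n) (p : nat).

Definition prefix_count b p : nat := \sum_(q < n | (q < p)%N) b q.

Lemma prefix_count0 b : prefix_count b 0 = 0%N.
Proof. by rewrite /prefix_count big_pred0. Qed.

Lemma prefix_countS b i : prefix_count b i.+1 = (prefix_count b i + b i)%N.
Proof.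
rewrite /prefix_count (bigD1 i) //= addnC; congr (_ + _)%N.
by apply: eq_bigl => q; rewrite ltnS [RHS]ltn_neqAle andbC.
Qed.

Lemma prefix_count_le b1 b2 p :
  (forall q, b1 q -> b2 q) -> (prefix_count b1 p <= prefix_count b2 p)%N.
Proof.
by move=> b12; apply: leq_sum => q _; case: (b1 q) (b12 q) => // ->.
Qed.

Lemma prefix_count_homo b p p' :
  (p <= p')%N -> (prefix_count b p <= prefix_count b p')%N.
Proof.
move=> pp'; rewrite /prefix_count big_mkcond [X in (_ <= X)%N]big_mkcond /=.
by apply: leq_sum => q _; case: ltnP => // qp; rewrite (leq_trans qp pp').
Qed.

Lemma prefix_count_full b : prefix_count b n = #|[set q | b q]|.
Proof.
rewrite /prefix_count -sum1_card [LHS]big_mkcond [RHS]big_mkcond.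
by apply: eq_bigr => q _; rewrite ltn_ord inE; case: (b q).
Qed.

Lemma eq_prefix_count b1 b2 p : (forall q, (q < p)%N -> b1 q = b2 q) ->
  prefix_count b1 p = prefix_count b2 p.
Proof. by move=> b12; apply: eq_bigr => q /b12 ->. Qed.

(** Only the prefix of length [i.+1] separates the two exchanged positions. *)
Lemma prefix_count_tperm b i i' p : i' = i.+1 :> nat -> p != i.+1 ->
  prefix_count (fun q => b (tperm i i' q)) p = prefix_count b p.
Proof.
move=> ii' /eqP pi; have [pi1|ip] := leqP p i.
  apply: eq_prefix_count => q qp; rewrite tpermD //.
  - by apply/eqP => iq; rewrite iq in pi1; lia.
  - by apply/eqP => iq; rewrite -iq in qp; lia.
rewrite /prefix_count [RHS](reindex_inj (perm_inj (s := tperm i i'))) /=.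
apply: eq_bigl => q; case: tpermP => [->|->|//]; lia.
Qed.

Lemma prefix_count_tpermS b i i' : i' = i.+1 :> nat ->
  prefix_count (fun q => b (tperm i i' q)) i.+1 = (prefix_count b i + b i')%N.
Proof.
by move=> ii'; rewrite prefix_countS tpermL prefix_count_tperm // neq_ltn ltnSn.
Qed.

(** The count grows by at most one per position, so the first prefix whose count exceeds [r] ends
    with a marked position preceded by exactly [r] others. *)
Lemma prefix_count_reach b r : (r < prefix_count b n)%N ->
  exists2 i, b i & prefix_count b i = r.
Proof.
move=> rn; have ex : exists p, (r < prefix_count b p)%N by exists n.
case: (ex_minnP ex) => -[|p] rp pmin; first by rewrite prefix_count0 in rp.
have pn : (p < n)%N by apply: pmin.
have := prefix_countS b (Ordinal pn); rewrite /= => cS.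
have cp : (prefix_count b p <= r)%N.
  by rewrite leqNgt; apply/negP => /pmin; rewrite ltnn.
by exists (Ordinal pn); move: rp; rewrite cS; case: (b _) => /=; lia.
Qed.

Lemma prefix_count_inj b i q : b i -> b q ->
  prefix_count b i = prefix_count b q -> i = q.
Proof.
move=> bi bq iq; apply: val_inj; case: (ltngtP i q) => // [lt|lt].
  by have := prefix_count_homo b lt; rewrite prefix_countS bi; lia.
by have := prefix_count_homo b lt; rewrite prefix_countS bq; lia.
Qed.

End PrefixCount.

Section AveragedProfile.
Variables (R : realType) (m : nat).
Implicit Types D : nat -> R.

Definition average_at (r : nat) D (i : nat) : R :=
  if i == r then (D r.-1 + D r.+1) / 2 else D i.

Definition concave_profile D : Prop :=
  [/\ D 0%N = 0, D m = 0, forall i, (i <= m)%N -> 0 <= D i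
    & forall r, (0 < r < m)%N -> D r.-1 + D r.+1 <= 2 * D r].

Definition profile_mass D : R := \sum_(i < m.+1) D i.

Definition concavity_gap D (r : nat) : R := 2 * D r - D r.-1 - D r.+1.

Lemma average_le r D i : (0 < r < m)%N -> concave_profile D ->
  average_at r D i <= D i.
Proof.
move=> rm [_ _ _ Dc]; rewrite /average_at; case: eqP => // ->.
by have := Dc r rm; lra.
Qed.

(** Averaging makes the profile affine around [r]; elsewhere it can only lower the neighbours of an
    unchanged value. *)
Lemma concave_average r D : (0 < r < m)%N -> concave_profile D ->
  concave_profile (average_at r D).
Proof.
move=> rm [D0 Dm Dge Dc]; have Dr := Dc r rm; split.
- by rewrite /average_at; case: eqP => // ?; lia.
- by rewrite /average_at; case: eqP => // ?; lia.
- move=> i im; rewrite /average_at; case: eqP => // _; last exact: Dge.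
  have := Dge r.-1 ltac:(lia); have := Dge r.+1 ltac:(lia); lra.
- move=> q qm; have [->|qr] := eqVneq q r.
    by rewrite /average_at eqxx !ifF; [lra | lia | lia].
  rewrite [in leRHS]/average_at (negbTE qr).
  have := average_le q.-1 rm (And4 D0 Dm Dge Dc).
  have := average_le q.+1 rm (And4 D0 Dm Dge Dc).
  by have := Dc q qm; lra.
Qed.

Lemma profile_mass_average r D : (0 < r < m)%N ->
  profile_mass (average_at r D) = profile_mass D - concavity_gap D r / 2.
Proof.
move=> /andP[r0 rm]; have rm' : (r < m.+1)%N by lia.
rewrite /profile_mass (bigD1 (Ordinal rm')) //= [in RHS](bigD1 (Ordinal rm')) //=.
rewrite /average_at eqxx /concavity_gap (eq_bigr (fun i : 'I_m.+1 => D i)).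
  by field.
by move=> i /eqP ir; case: eqP => // e; case: ir; apply: val_inj.
Qed.

(** The gaps are differences of successive slopes and telescope to [D 1 + D m.-1], while concavity
    gives [D r <= r * D 1], so the mass is at most [m ^ 2 * D 1]. *)
Lemma profile_mass_le_gaps D : (0 < m)%N -> concave_profile D ->
  profile_mass D <= m%:R ^+ 2 * \sum_(1 <= r < m) concavity_gap D r.
Proof.
move=> m0 [D0 Dm Dge Dc].
have gapsum : \sum_(1 <= r < m) concavity_gap D r = D 1%N + D m.-1.
  rewrite (eq_bigr (fun r => (D r - D r.-1) - (D r.+1 - D r.+1.-1))); last first.
    by move=> r _; rewrite /concavity_gap /=; ring.
  rewrite (telescope_sumr_eq (fun r => - (D r - D r.-1))) //=.
    by rewrite D0 Dm; ring.
  by move=> r _; ring.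
have step r : (r < m)%N -> D r.+1 - D r <= D 1%N.
  elim: r => [|r IHr] rm; first by rewrite D0 subr0.
  have := IHr ltac:(lia); have := Dc r.+1 ltac:(lia); rewrite /=; lra.
have D1 : 0 <= D 1%N by apply: Dge.
have lin r : (r <= m)%N -> D r <= r%:R * D 1%N.
  elim: r => [|r IHr] rm; first by rewrite D0 mul0r.
  have := IHr ltac:(lia); have := step r rm; rewrite mulrS; lra.
rewrite gapsum /profile_mass big_ord_recl D0 add0r.
apply: (@le_trans _ _ (\sum_(i < m) m%:R * D 1%N)).
  apply: ler_sum => i _; apply: le_trans (lin _ _) _; first by rewrite /= ltn_ord.
  by rewrite ler_wpM2r // ler_nat /= ltn_ord.
rewrite sumr_const card_ord -[leLHS]mulr_natl mulrA -expr2 ler_wpM2l ?exprn_ge0 //.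
by rewrite lerDl Dge // leq_pred.
Qed.

End AveragedProfile.

(** * The particle system and its action on profiles *)

Lemma sum_pred1_mul (R : realType) (T : finType) (x : T) (f : T -> R) :
  \sum_y (y == x)%:R * f y = f x.
Proof.
by rewrite (bigD1 x) //= eqxx mul1r big1 ?addr0 // => y /negbTE ->; rewrite mul0r.
Qed.

Lemma sum_move_or_stay (R : realType) (T : finType) a (x y : T) (f : T -> R) :
  \sum_z move_or_stay a x y z * f z = a * f y + (1 - a) * f x.
Proof.
rewrite -(sum_pred1_mul y f) -(sum_pred1_mul x f) !mulr_sumr -big_split /=.
by apply: eq_bigr => z _; rewrite /move_or_stay; ring.
Qed.

Lemma chain_op_adjacent_mean (R : realType) (n : nat) (T : finType)
    (K : T -> T -> 'I_n -> 'I_n -> R) (f : T -> R) x :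
  chain_op (fun x y => adjacent_mean (K x y)) f x =
  adjacent_mean (fun i i' => \sum_y K x y i i' * f y).
Proof.
rewrite adjacent_mean_sum; apply: eq_bigr => y _; rewrite mulrC -adjacent_meanZ.
by apply: eq_adjacent_mean => i i' _; rewrite mulrC.
Qed.

Section Particles.
Variables (R : realType) (n k : nat) (team : 'I_n -> 'I_k) (s : 'I_k -> R).
Hypotheses (n2 : (2 <= n)%N) (s_gt0 : forall j, 0 < s j).
Implicit Types (x y : particle_state team) (sigma : {perm 'I_n}) (i : 'I_n).
Local Notation X := (particle_state team).
Local Notation P := (linear_particle_system team s).

Definition forward_prob (t t' : 'I_k) : R := s t / (s t + s t').

Lemma forward_prob_bounds t t' : 0 <= forward_prob t t' <= 1.
Proof.
have := s_gt0 t; have := s_gt0 t' => h h'.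
by rewrite /forward_prob divr_ge0 ?ler_pdivrMr //=; lra.
Qed.

Lemma forward_prob_same t : forward_prob t t = 2^-1.
Proof. by have := s_gt0 t; rewrite /forward_prob => h; field; lra. Qed.

Lemma arrangement_card x j : #|[set p | val x p == j]| = #|team_set team j|.
Proof. by have /forallP/(_ j)/eqP := valP x. Qed.

Lemma exchange_arrangement x i i' :
  arrangement_of (fun j => #|team_set team j|) (exchange (val x) i i').
Proof.
apply/forallP => j; apply/eqP; rewrite -(arrangement_card x j).
rewrite -[RHS](card_preimset _ (perm_inj (s := tperm i i'))).
by apply: eq_card => p; rewrite !inE ffunE.
Qed.

Definition exchange_state x i i' : X :=
  exist (fun z => arrangement_of _ z) _ (exchange_arrangement x i i').

Lemma exchange_stateE x i i' p :
  val (exchange_state x i i') p = val x (tperm i i' p).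
Proof. by rewrite /= ffunE. Qed.

Lemma exchange_stateK x i i' : exchange_state (exchange_state x i i') i i' = x.
Proof. by apply: val_inj; apply/ffunP => p; rewrite !exchange_stateE tpermK. Qed.

Lemma linear_particle_system_op (f : X -> R) x : chain_op P f x =
  adjacent_mean (fun i i' => if val x i == val x i' then f x else
    forward_prob (val x i) (val x i') * f (exchange_state x i i') +
    (1 - forward_prob (val x i) (val x i')) * f x).
Proof.
rewrite chain_op_adjacent_mean; apply: eq_adjacent_mean => i i' _ /=.
case: eqP => _; first exact: sum_pred1_mul.
by rewrite -sum_move_or_stay; apply: eq_bigr => y _; congr (_ * _).
Qed.

Lemma linear_particle_system_row_sum x : \sum_y P x y = 1.
Proof.
transitivity (chain_op P (fun=> 1) x).
  by apply: eq_bigr => y _; rewrite mulr1.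
rewrite linear_particle_system_op -[RHS](adjacent_mean_cst 1 n2).
by apply: eq_adjacent_mean => i i' _; case: ifP => // _; ring.
Qed.

Definition rank_of (j : 'I_k) x (p : nat) : nat :=
  prefix_count (fun q => val x q == j) p.

Lemma rank_of_full j x : rank_of j x n = #|team_set team j|.
Proof. by rewrite /rank_of prefix_count_full arrangement_card. Qed.

Lemma rank_of_pair j x i i' : i' = i.+1 :> nat -> val x i = j -> val x i' = j ->
  rank_of j x i.+2 = (rank_of j x i).+2.
Proof.
move=> ii' xi xi'; rewrite /rank_of -ii' prefix_countS ii' prefix_countS xi xi'.
by rewrite eqxx !addn1.
Qed.

Lemma rank_of_pair_lt j x i i' : i' = i.+1 :> nat -> val x i = j -> val x i' = j ->
  (0 < (rank_of j x i).+1 < #|team_set team j|)%N.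
Proof.
move=> ii' xi xi'; rewrite /= -(rank_of_full j x) -(rank_of_pair ii' xi xi').
by apply: prefix_count_homo; rewrite -ii'.
Qed.

(** The cut between the two particles is named by the number [r] of particles of type [j] to its
    left, so the possible [r] are the interior points of a profile. *)
Definition adjacent_at (j : 'I_k) (r : nat) x : bool :=
  [exists i : 'I_n, exists i' : 'I_n, [&& i' == i.+1 :> nat, val x i == j, val x i' == j
                          & (rank_of j x i).+1 == r]].

(** * Expected mass of a profile carried along by the particle system *)

Section Team.
Variable j : 'I_k.
Local Notation m := #|team_set team j|.
Implicit Types (D : nat -> R) (phi : X -> (nat -> R) -> R).

(* Profiles are indexed by the rank within team j, so that exchanges of
   particles of different types leave them unchanged. *)
Definition profile_op phi x D : R :=
  adjacent_mean (fun i i' =>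
    if val x i == val x i' then
      if val x i == j then phi x (average_at (rank_of j x i).+1 D) else phi x D
    else forward_prob (val x i) (val x i') * phi (exchange_state x i i') D +
         (1 - forward_prob (val x i) (val x i')) * phi x D).

Definition mass_after (t : nat) : X -> (nat -> R) -> R :=
  iter t profile_op (fun=> profile_mass m).

(** Local averaging is linear and monotone in the profile. One inequality packs both facts; it
    serves to merge the two outcomes of a coupled exchange into a single profile. *)
Lemma mass_after_sublinear t x (a1 a2 : R) D1 D2 D3 : 0 <= a1 -> 0 <= a2 ->
  (forall q : nat, a1 * D1 q + a2 * D2 q <= D3 q) ->
  a1 * mass_after t x D1 + a2 * mass_after t x D2 <= mass_after t x D3.
Proof.
move=> a1_ge0 a2_ge0; elim: t x D1 D2 D3 => [|t IHt] x D1 D2 D3 le3 /=.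
  rewrite /mass_after /= /profile_mass !mulr_sumr -big_split /=.
  by apply: ler_sum => q _; apply: le3.
rewrite /mass_after /= -/(mass_after t) -!adjacent_meanZ -adjacent_meanD.
apply: le_adjacent_mean => i i' _; case: ifP => [_|xii'].
  case: ifP => _; apply: IHt => // q; rewrite /average_at /=; case: eqP => // _.
  by have := le3 (rank_of j x i); have := le3 (rank_of j x i).+2; lra.
have [p0 p1] := andP (forward_prob_bounds (val x i) (val x i')).
set p := forward_prob _ _ in p0 p1 *.
have := IHt (exchange_state x i i') _ _ _ le3.
have := IHt x _ _ _ le3.
rewrite -(subr_ge0 p) in p1 => /(ler_wpM2l p1) h1 /(ler_wpM2l p0) h2.
by apply: le_trans (lerD h2 h1); rewrite le_eqVlt; apply/orP; left; apply/eqP; ring.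
Qed.

Lemma profile_op_le phi psi :
  (forall x D, concave_profile m D -> phi x D <= psi x D) ->
  forall x D, concave_profile m D -> profile_op phi x D <= profile_op psi x D.
Proof.
move=> le_phi x D cD; apply: le_adjacent_mean => i i' ii'.
case: eqP => [xii'|_].
  case: eqP => [xi|_]; last exact: le_phi.
  apply: le_phi; apply: concave_average => //.
  by apply: (rank_of_pair_lt ii') => //; rewrite -xii'.
have [p0 p1] := andP (forward_prob_bounds (val x i) (val x i')).
by rewrite lerD // ler_wpM2l ?subr_ge0 // le_phi.
Qed.

Lemma profile_op_iter_le L phi psi :
  (forall x D, concave_profile m D -> phi x D <= psi x D) ->
  forall x D, concave_profile m D ->
    iter L profile_op phi x D <= iter L profile_op psi x D.
Proof. by move=> le_phi; elim: L => [|L IHL] //=; apply: profile_op_le. Qed.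

Lemma profile_op_iterZ L phi a x D :
  iter L profile_op (fun x D => a * phi x D) x D = a * iter L profile_op phi x D.
Proof.
elim: L x D => [|L IHL] //= x D; rewrite /profile_op -adjacent_meanZ.
apply: eq_adjacent_mean => i i' _; do 2?case: ifP => _; rewrite ?IHL //.
by ring.
Qed.

(** A selected pair of type [j] takes away half the concavity gap at its rank, and a given pair is
    selected with probability [n.-1%:R^-1]. *)
Lemma profile_op_mass_le x D : concave_profile m D ->
  profile_op (fun=> profile_mass m) x D <= profile_mass m D -
    n.-1%:R^-1 / 2 * \sum_(1 <= r < m) (adjacent_at j r x)%:R * concavity_gap D r.
Proof.
move=> cD; have [D0 Dm Dge Dc] := cD.
pose hit r i i' := [&& val x i == j, val x i' == j & (rank_of j x i).+1 == r].
have -> : profile_op (fun=> profile_mass m) x D = profile_mass m D +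
   - 2^-1 * adjacent_mean (fun i i' =>
     \sum_(1 <= r < m) (hit r i i')%:R * concavity_gap D r).
  rewrite -[X in _ = X + _](adjacent_mean_cst (profile_mass m D) n2).
  rewrite -adjacent_meanZ -adjacent_meanD.
  apply: eq_adjacent_mean => i i' ii'; case: eqP => [xii'|xii'].
    case: eqP => [xi|xi]; last first.
      rewrite big1 ?mulr0 ?addr0 // => r _.
      by rewrite /hit (negbTE (introN eqP xi)) mul0r.
    have rlt := rank_of_pair_lt ii' xi (etrans (esym xii') xi).
    rewrite profile_mass_average //.
    rewrite (bigD1_seq (rank_of j x i).+1) ?iota_uniq //=; last first.
      by rewrite mem_index_iota.
    rewrite /hit -xii' xi !eqxx mul1r big1 ?addr0; first by rewrite mulrC mulNr.
    by move=> r /negbTE; rewrite eq_sym => ->; rewrite mul0r.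
  rewrite big1 ?mulr0 ?addr0; first by ring.
  move=> r _; rewrite /hit; case: eqP => [xi|]; case: eqP => [xi'|] /=; rewrite ?mul0r //.
  by case: xii'; rewrite xi xi'.
suff key : n.-1%:R^-1 * \sum_(1 <= r < m) (adjacent_at j r x)%:R * concavity_gap D r
    <= adjacent_mean (fun i i' =>
         \sum_(1 <= r < m) (hit r i i')%:R * concavity_gap D r) by lra.
rewrite adjacent_mean_sum mulr_sumr; apply: ler_sum_nat => r rm.
have gap0 : 0 <= concavity_gap D r by have := Dc r rm; rewrite /concavity_gap; lra.
have -> : adjacent_mean (fun i i' => (hit r i i')%:R * concavity_gap D r) =
    concavity_gap D r * adjacent_mean (fun i i' => (hit r i i')%:R).
  by rewrite -adjacent_meanZ; apply: eq_adjacent_mean => i i' _; rewrite mulrC.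
rewrite [leLHS](_ : _ = concavity_gap D r *
  (n.-1%:R^-1 * (adjacent_at j r x)%:R)); last by ring.
rewrite ler_wpM2l // ler_wpM2l ?invr_ge0 ?ler0n //.
case: (boolP (adjacent_at j r x)) => [/existsP[i /existsP[i' /and4P[ii' xi xi' rk]]]|_].
  rewrite (bigD1 i) //= (bigD1 i') //= /hit xi xi' rk /= -addrA lerDl addr_ge0 //.
    by apply: sumr_ge0 => q _; rewrite ler0n.
  by apply: sumr_ge0 => q _; apply: sumr_ge0 => q' _; rewrite ler0n.
by apply: sumr_ge0 => q _; apply: sumr_ge0 => q' _; rewrite ler0n.
Qed.

(* A drop of D' below D lowers a concavity gap of D' by at most twice the mass
   already lost, so either mass was lost on the way or the gap is still there
   when the particles meet. *)
Lemma concavity_gap_sum_le x D D' : (0 < m)%N ->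
    (forall q, (q <= m)%N -> D' q <= D q) ->
  \sum_(1 <= r < m) (adjacent_at j r x)%:R * concavity_gap D r -
    2 * (profile_mass m D - profile_mass m D') <=
  \sum_(1 <= r < m) (adjacent_at j r x)%:R * concavity_gap D' r.
Proof.
move=> m0 D'D; rewrite /profile_mass -sumrB.
have : \sum_(1 <= r < m) (D r - D' r) <= \sum_(i < m.+1) (D i - D' i).
  rewrite -(big_mkord xpredT (fun r => D r - D' r)).
  rewrite big_nat_recr //= [X in _ <= X + _]big_ltn // -addrA [leRHS]addrC -addrA.
  rewrite lerDl.
  by rewrite addr_ge0 // subr_ge0 D'D.
suff : \sum_(1 <= r < m) (adjacent_at j r x)%:R * concavity_gap D r -
    2 * (\sum_(1 <= r < m) (D r - D' r)) <=
  \sum_(1 <= r < m) (adjacent_at j r x)%:R * concavity_gap D' r by lra.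
rewrite mulr_sumr -sumrB; apply: ler_sum_nat => r rm; rewrite /concavity_gap.
have := D'D r ltac:(lia); have := D'D r.-1 ltac:(lia); have := D'D r.+1 ltac:(lia).
by case: adjacent_at => /=; rewrite ?mul1r ?mul0r; lra.
Qed.

(** Only the last of the [L.+1] steps is credited with a loss. Measuring gaps on the fixed [D0]
    while [D] descends lets the chance of a meeting be read from the particle system alone; the
    price, through [concavity_gap_sum_le], is the convex combination of the two masses. *)
Lemma mass_after_block L a x D D0 : (0 < m)%N -> a = n.-1%:R^-1 ->
  concave_profile m D -> (forall q, (q <= m)%N -> D q <= D0 q) ->
  iter L profile_op (profile_op (fun=> profile_mass m)) x D <=
  (1 - a) * profile_mass m D + a * profile_mass m D0 - a / 2 *
   \sum_(1 <= r < m)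
     iter L (chain_op P) (fun y => (adjacent_at j r y)%:R) x * concavity_gap D0 r.
Proof.
move=> m0 aE cD DD0.
have a0 : 0 <= a by rewrite aE invr_ge0 ler0n.
have a1 : a <= 1 by rewrite aE invf_le1 ?ler1n ?ltr0n; lia.
elim: L x D cD DD0 => [|L IHL] x D cD DD0 /=.
  apply: le_trans (profile_op_mass_le x cD) _.
  have := concavity_gap_sum_le x m0 DD0; rewrite -aE.
  by move=> /(ler_wpM2l a0); lra.
pose S y := \sum_(1 <= r < m)
  iter L (chain_op P) (fun y => (adjacent_at j r y)%:R) y * concavity_gap D0 r.
have {}IHL y E : concave_profile m E -> (forall q, (q <= m)%N -> E q <= D0 q) ->
    iter L profile_op (profile_op (fun=> profile_mass m)) y E <=
    (1 - a) * profile_mass m E + a * profile_mass m D0 + - (a / 2) * S y.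
  by move=> cE ED0; rewrite mulNr; apply: IHL.
have -> : \sum_(1 <= r < m) chain_op P (iter L (chain_op P)
    (fun y => (adjacent_at j r y)%:R)) x * concavity_gap D0 r = chain_op P S x.
  under eq_bigr do rewrite /chain_op mulr_suml.
  rewrite exchange_big /=; apply: eq_bigr => y _; rewrite mulr_sumr.
  by apply: eq_bigr => r _; rewrite mulrA.
set c := (1 - a) * _ + _.
rewrite linear_particle_system_op -[c](adjacent_mean_cst c n2).
rewrite -mulNr -adjacent_meanZ -adjacent_meanD; apply: le_adjacent_mean => i i' ii'.
case: eqP => [xii'|_].
  case: eqP => [xi|_]; last exact: IHL.
  have rlt := rank_of_pair_lt ii' xi (etrans (esym xii') xi).
  apply: le_trans (IHL x _ (concave_average rlt cD) _) _.
    by move=> q qm; apply: le_trans (average_le _ rlt cD) (DD0 q qm).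
  rewrite lerD2r lerD2r ler_wpM2l ?subr_ge0 //.
  by apply: ler_sum => q _; apply: average_le rlt cD.
have [p0 p1] := andP (forward_prob_bounds (val x i) (val x i')).
set p := forward_prob _ _ in p0 p1 *.
have := IHL (exchange_state x i i') _ cD DD0; rewrite -/c.
have := IHL x _ cD DD0; rewrite -/c.
rewrite -(subr_ge0 p) in p1 => /(ler_wpM2l p1) h1 /(ler_wpM2l p0) h2.
by apply: le_trans (lerD h2 h1) _; lra.
Qed.

(** With [D0 = D] the two masses in [mass_after_block] merge; [rho] and [profile_mass_le_gaps] then
    turn the loss into a fixed fraction of the mass for each block of [L.+1] steps. *)
Lemma mass_after_decay L (rho : R) : (0 < m)%N -> 0 <= rho <= 1 ->
    (forall r x, (0 < r < m)%N ->
       rho <= iter L (chain_op P) (fun y => (adjacent_at j r y)%:R) x) ->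
  forall b x D, concave_profile m D ->
    mass_after (b * L.+1) x D <=
      (1 - n.-1%:R^-1 * rho / (2 * m%:R ^+ 2)) ^+ b * profile_mass m D.
Proof.
move=> m0 /andP[rho0 rho1] Hrho; set a := n.-1%:R^-1; set gam := _ / (_ * _).
have a0 : 0 <= a by rewrite invr_ge0 ler0n.
have block x D : concave_profile m D ->
    iter L.+1 profile_op (fun=> profile_mass m) x D <= (1 - gam) * profile_mass m D.
  move=> cD; rewrite iterSr.
  apply: le_trans (mass_after_block L x m0 (erefl a) cD (fun _ _ => lexx _)) _.
  have [D0 Dm Dge Dc] := cD.
  have m2 : 0 < m%:R ^+ 2 :> R by rewrite exprn_gt0 // ltr0n.
  have gaps := profile_mass_le_gaps m0 cD.
  set S := \sum_(1 <= r < m) iter L _ _ x * _.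
  have rhoS : rho * \sum_(1 <= r < m) concavity_gap D r <= S.
    rewrite mulr_sumr; apply: ler_sum_nat => r rm; rewrite ler_wpM2r ?Hrho //.
    by have := Dc r rm; rewrite /concavity_gap; lra.
  have rhoM : rho * profile_mass m D / m%:R ^+ 2 <= S.
    apply: le_trans rhoS; rewrite -mulrA ler_wpM2l // ler_pdivrMr //.
    by rewrite mulrC.
  have -> : gam = a / 2 * (rho / m%:R ^+ 2).
    by rewrite /gam; field; rewrite pnatr_eq0 -lt0n.
  have := ler_wpM2l a0 rhoM; lra.
elim=> [|b IHb] x D cD; first by rewrite mul0n expr0 mul1r.
(* Innermost iterates are latest in time: the last block is estimated first, on whatever concave
   profile it receives. *)
rewrite mulSn addnC /mass_after iterD.
apply: le_trans (profile_op_iter_le _ block x cD) _.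
rewrite profile_op_iterZ exprS -mulrA ler_wpM2l ?IHb // subr_ge0 /gam.
have a1 : a <= 1 by rewrite invf_le1 ?ler1n ?ltr0n; lia.
have m1 : 1 <= m%:R ^+ 2 :> R by rewrite exprn_ege1 // ler1n.
rewrite ler_pdivrMr; last by lra.
have : a * rho <= 1 by rewrite mulr_ile1.
by lra.
Qed.

End Team.

(** Gladiators are replaced by 0-1 threshold labels, one labelling for each [g]. Sorting a pair of
    team-mates sorts every labelling, and all labellings together determine the permutation. *)
Definition teammate_upto (g : 'I_n) : pred 'I_n :=
  fun h => (team h == team g) && (h <= g)%N.

Definition low_count (g : 'I_n) sigma (p : nat) : nat :=
  prefix_count (fun q => teammate_upto g (sigma q)) p.

Lemma arrangement_state_proof sigma :
  arrangement_of (fun j => #|team_set team j|) [ffun p => team (sigma p)].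
Proof.
apply/forallP => j; apply/eqP.
rewrite -[RHS](card_preimset _ (perm_inj (s := sigma))).
by apply: eq_card => p; rewrite !inE ffunE.
Qed.

Definition arrangement_state sigma : X :=
  exist (fun z => arrangement_of _ z) _ (arrangement_state_proof sigma).

Lemma arrangement_stateE sigma p : val (arrangement_state sigma) p = team (sigma p).
Proof. by rewrite /= ffunE. Qed.

Lemma arrangement_state_tperm sigma i i' :
  arrangement_state (tperm i i' * sigma) = exchange_state (arrangement_state sigma) i i'.
Proof.
apply: val_inj; apply/ffunP => p.
by rewrite exchange_stateE !arrangement_stateE permM.
Qed.

Lemma arrangement_state_tperm_same sigma i i' : team (sigma i) = team (sigma i') ->
  arrangement_state (tperm i i' * sigma) = arrangement_state sigma.
Proof.
move=> ii'; apply: val_inj; apply/ffunP => p.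
by rewrite !arrangement_stateE permM; case: tpermP => // ->.
Qed.

Lemma gladiator_chain_op (f : {perm 'I_n} -> R) sigma :
  chain_op (gladiator_chain team s) f sigma =
  adjacent_mean (fun i i' =>
    forward_prob (team (sigma i)) (team (sigma i')) * f (tperm i i' * sigma)%g +
    (1 - forward_prob (team (sigma i)) (team (sigma i'))) * f sigma).
Proof.
rewrite chain_op_adjacent_mean; apply: eq_adjacent_mean => i i' _ /=.
exact: sum_move_or_stay.
Qed.

(** An exchange of team-mates does not change the arrangement, so on functions of the arrangement
    the two chains act alike. *)
Lemma gladiator_chain_lump t (f : X -> R) sigma :
  iter t (chain_op (gladiator_chain team s)) (f \o arrangement_state) sigma =
  iter t (chain_op P) f (arrangement_state sigma).
Proof.
elim: t sigma => //= t IHt sigma.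
rewrite gladiator_chain_op linear_particle_system_op; apply: eq_adjacent_mean => i i' _.
rewrite !IHt !arrangement_stateE; case: eqP => [ii'|_]; last first.
  by rewrite arrangement_state_tperm.
by rewrite arrangement_state_tperm_same //; ring.
Qed.

(** The bound is indexed by rank rather than position, so that it survives exchanges across teams.
    It is applied to permutations with equal arrangements. *)
Definition dominated (D : 'I_n -> nat -> R) sigma sigma' : Prop :=
  forall g p, (p <= n)%N ->
    `|(low_count g sigma p)%:R - (low_count g sigma' p)%:R| <=
    D g (rank_of (team g) (arrangement_state sigma) p).

(** Consecutive prefixes give back the label at each position; the thresholds [sigma p] and
    [sigma' p] then yield the two inequalities between these gladiators. *)
Lemma low_count_separates sigma sigma' :
  (forall g p, (p <= n)%N -> low_count g sigma p = low_count g sigma' p) ->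
  sigma = sigma'.
Proof.
move=> eq_low; apply/permP => p.
have same g : teammate_upto g (sigma p) = teammate_upto g (sigma' p).
  have := eq_low g p.+1 (ltn_ord p); rewrite /low_count !prefix_countS.
  rewrite -!/(low_count g _ _) eq_low ?(ltnW (ltn_ord p)) // => /addnI.
  by do 2!case: teammate_upto.
apply: val_inj; apply/eqP; rewrite eqn_leq.
have := same (sigma p); have := same (sigma' p).
by rewrite /teammate_upto !eqxx !leqnn /= => /andP[_ ->] /esym/andP[_ ->].
Qed.

(* Swapping or not swapping two neighbours of a team sorts their 0-1 labels in
   one of the two orders; sorting is an l^1 contraction on pairs. *)
Lemma sort_contraction (h h' : R) (a b a' b' : bool) :
  `|h + (a || b)%:R - (h' + (a' || b')%:R)| +
  `|h + (a && b)%:R - (h' + (a' && b')%:R)| <=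
  `|h - h'| + `|h + a%:R + b%:R - (h' + a'%:R + b'%:R)|.
Proof.
case: a; case: b; case: a'; case: b' => /=; do 4?case: ger0P => ?; lra.
Qed.

End Particles.

(** * Two gladiator chains with the same arrangement *)

Section Labels.
Variables (R : realType) (n k : nat) (team : 'I_n -> 'I_k) (s : 'I_k -> R).
Hypotheses (n2 : (2 <= n)%N) (s_gt0 : forall j, 0 < s j).
Implicit Types (x y : particle_state team) (sigma : {perm 'I_n}) (i g : 'I_n).
Implicit Types (D : 'I_n -> nat -> R).

Definition sort_pair (i i' : 'I_n) (up : bool) sigma : {perm 'I_n} :=
  if (sigma i < sigma i')%N == up then sigma else (tperm i i' * sigma)%g.

(** Seen from the team of [g], the cut inside the exchanged pair corresponds to an old cut just
    before or just after the pair. Types alone decide which, so the same [p'] serves both coupled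
    copies. *)
Lemma low_count_cross g sigma i i' p :
    i' = i.+1 :> nat -> team (sigma i) != team (sigma i') -> (p <= n)%N ->
  exists2 p', (p' <= n)%N &
    forall tau, arrangement_state team tau = arrangement_state team sigma ->
      low_count team g (tperm i i' * tau)%g p = low_count team g tau p' /\
      rank_of (team g) (arrangement_state team (tperm i i' * tau)%g) p =
      rank_of (team g) (arrangement_state team tau) p'.
Proof.
move=> ii' tii' pn.
have cnt_tperm (b : pred 'I_n) tau : p != i.+1 ->
    prefix_count (fun q => b ((tperm i i' * tau)%g q)) p =
    prefix_count (fun q => b (tau q)) p.
  move=> pi; rewrite -(prefix_count_tperm (fun q => b (tau q)) ii' pi).
  by apply: eq_prefix_count => q _; rewrite permM.
have cnt_tpermS (b : pred 'I_n) tau :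
    prefix_count (fun q => b ((tperm i i' * tau)%g q)) i.+1 =
    (prefix_count (fun q => b (tau q)) i + b (tau i'))%N.
  rewrite -(prefix_count_tpermS (fun q => b (tau q)) ii').
  by apply: eq_prefix_count => q _; rewrite permM.
have rankE tau q : rank_of (team g) (arrangement_state team tau) q =
    prefix_count (fun q => team (tau q) == team g) q.
  by apply: eq_prefix_count => z _; rewrite arrangement_stateE.
have [->|pi] := eqVneq p i.+1; last first.
  exists p => // tau _; split; first exact: cnt_tperm.
  by rewrite !rankE (cnt_tperm (fun h => team h == team g)).
have teamE tau q : arrangement_state team tau = arrangement_state team sigma ->
    team (tau q) = team (sigma q).
  by move=> /(congr1 (fun x => val x q)); rewrite !arrangement_stateE.
have [tg|tg] := boolP (team (sigma i') == team g); last first.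
  exists i; first exact: ltnW (ltn_ord i).
  move=> tau /teamE tauE; rewrite !rankE (cnt_tpermS (fun h => team h == team g)).
  rewrite /low_count cnt_tpermS /teammate_upto tauE (negbTE tg) /=.
  by rewrite !addn0.
exists i.+2; first by rewrite -ii' ltn_ord.
move=> tau /teamE tauE.
have tg' : (team (sigma i) == team g) = false.
  by apply/negbTE; rewrite -(eqP tg).
rewrite !rankE (cnt_tpermS (fun h => team h == team g)) /low_count cnt_tpermS.
rewrite -ii' !prefix_countS ii' !prefix_countS.
by rewrite /teammate_upto !tauE tg tg' /= !addn0.
Qed.

Lemma sort_pair_arrangement i i' up sigma : team (sigma i) = team (sigma i') ->
  arrangement_state team (sort_pair i i' up sigma) = arrangement_state team sigma.
Proof.
move=> tii'; rewrite /sort_pair; case: ifP => // _.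
exact: arrangement_state_tperm_same.
Qed.

Lemma low_count_sort_pair g i i' up sigma p : i' = i.+1 :> nat -> p != i.+1 ->
  low_count team g (sort_pair i i' up sigma) p = low_count team g sigma p.
Proof.
move=> ii' pi; rewrite /sort_pair; case: ifP => // _; rewrite /low_count.
rewrite -[RHS](prefix_count_tperm _ ii' pi).
by apply: eq_prefix_count => q _; rewrite permM.
Qed.

(** Within a team, threshold labels do not increase with the index: increasing order puts a 1 first
    if there is one, decreasing order only if both are 1. *)
Lemma low_count_sort_pairS g i i' up sigma :
    i' = i.+1 :> nat -> team (sigma i) = team (sigma i') ->
  let a := teammate_upto team g (sigma i) in
  let b := teammate_upto team g (sigma i') in
  low_count team g (sort_pair i i' up sigma) i.+1 =
  (low_count team g sigma i + (if up then a || b else a && b))%N.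
Proof.
move=> ii' tii' a b.
have ne : sigma i != sigma i' :> nat.
  by rewrite val_eqE (inj_eq perm_inj) -val_eqE /= ii' neq_ltn ltnSn.
have straight : low_count team g sigma i.+1 = (low_count team g sigma i + a)%N.
  exact: prefix_countS.
have crossed : low_count team g (tperm i i' * sigma)%g i.+1 =
    (low_count team g sigma i + b)%N.
  rewrite -(prefix_count_tpermS (fun q => teammate_upto team g (sigma q)) ii').
  by apply: eq_prefix_count => q _; rewrite permM.
rewrite /sort_pair; case: ifP => [/eqP lt|/eqP lt]; rewrite ?straight ?crossed.
  congr (_ + _)%N; move: lt; rewrite /a /b /teammate_upto tii'.
  by case: up; case: (_ == _) => //=; lia.
congr (_ + _)%N; move: lt; rewrite /a /b /teammate_upto tii'.
by case: up; case: (_ == _) => //=; lia.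
Qed.


(** At the rank of the selected cut the bound becomes the actual difference for this value of [up];
    the average over [up] is taken in [sorted_profile_average]. *)
Definition sorted_profile (D : 'I_n -> nat -> R) i i' up sigma sigma' g (q : nat) : R :=
  if (team g == team (sigma i)) &&
     (q == (rank_of (team g) (arrangement_state team sigma) i).+1)
  then `|(low_count team g (sort_pair i i' up sigma) i.+1)%:R -
         (low_count team g (sort_pair i i' up sigma') i.+1)%:R|
  else D g q.

Lemma dominated_sort_pair D i i' up sigma sigma' : i' = i.+1 :> nat ->
    team (sigma i) = team (sigma i') ->
    arrangement_state team sigma = arrangement_state team sigma' ->
    dominated team D sigma sigma' ->
  dominated team (sorted_profile D i i' up sigma sigma')
    (sort_pair i i' up sigma) (sort_pair i i' up sigma').
Proof.
move=> ii' tii' arr dom g p pn.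
have teamE q : team (sigma' q) = team (sigma q).
  by move: arr => /(congr1 (fun x => val x q)); rewrite !arrangement_stateE.
have tii'2 : team (sigma' i) = team (sigma' i') by rewrite !teamE.
rewrite sort_pair_arrangement // /sorted_profile.
have rankS (q : 'I_n) : rank_of (team g) (arrangement_state team sigma) q.+1 =
   (rank_of (team g) (arrangement_state team sigma) q + (team (sigma q) == team g))%N.
  by rewrite /rank_of prefix_countS arrangement_stateE.
have [->|pi] := eqVneq p i.+1.
  rewrite rankS eq_sym; have [tg|tg] /= := eqVneq (team (sigma i)) (team g).
    by rewrite addn1 eqxx.
  rewrite !low_count_sort_pairS // /teammate_upto !teamE -tii' (negbTE tg) /=.
  have := dom g i (ltnW (ltn_ord i)); rewrite addn0.
  by case: (up); rewrite /= !addn0.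
rewrite !(low_count_sort_pair _ _ _ ii' pi).
case: andP => [[/eqP tg /eqP rk]|_]; last exact: dom.
(* With [r] the altered rank, prefixes ending before or after the pair have rank at most [r - 1] or
   at least [r + 1], so the altered entry is not consulted. *)
have [pi1|ip] := leqP p i.
  have := prefix_count_homo (fun q => val (arrangement_state team sigma) q == team g) pi1.
  by rewrite -!/(rank_of _ _ _) rk ltnn.
have : (i.+2 <= p)%N by rewrite ltn_neqAle eq_sym pi.
move=> /(prefix_count_homo (fun q => val (arrangement_state team sigma) q == team g)).
by rewrite -!/(rank_of _ _ _) rk -ii' rankS ii' rankS -tii' tg eqxx; lia.
Qed.

(** [sort_contraction] bounds the sum over the two orders by the differences at [i] and [i.+2],
    where the ranks are [r.-1] and [r.+1]. *)
Lemma sorted_profile_average D i i' sigma sigma' g : i' = i.+1 :> nat ->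
    team (sigma i) = team (sigma i') ->
    arrangement_state team sigma = arrangement_state team sigma' ->
    dominated team D sigma sigma' -> team g = team (sigma i) ->
  let r := (rank_of (team g) (arrangement_state team sigma) i).+1 in
  forall q : nat,
  2^-1 * sorted_profile D i i' true sigma sigma' g q +
  2^-1 * sorted_profile D i i' false sigma sigma' g q <= average_at r (D g) q.
Proof.
move=> ii' tii' arr dom tg r q.
have teamE q' : team (sigma' q') = team (sigma q').
  by move: arr => /(congr1 (fun x => val x q')); rewrite !arrangement_stateE.
have tii'2 : team (sigma' i) = team (sigma' i') by rewrite !teamE.
rewrite /sorted_profile /average_at tg eqxx /= -tg -/r; case: eqP => _; last by lra.
have lowS tau : low_count team g tau i.+2 = (low_count team g tau i +
    teammate_upto team g (tau i) + teammate_upto team g (tau i'))%N.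
  by rewrite /low_count -ii' prefix_countS ii' prefix_countS.
have := dom g i (ltnW (ltn_ord i)).
have := dom g i.+2; rewrite -{1}ii' => /(_ (ltn_ord i')).
rewrite (rank_of_pair ii') ?arrangement_stateE -?tii' //.
rewrite !low_count_sort_pairS // !lowS /r /= !natrD => h2 h1.
have := @sort_contraction R (low_count team g sigma i)%:R
  (low_count team g sigma' i)%:R (teammate_upto team g (sigma i))
  (teammate_upto team g (sigma i')) (teammate_upto team g (sigma' i))
  (teammate_upto team g (sigma' i')).
by lra.
Qed.

Lemma sorted_profile_other D i i' up sigma sigma' g : team g != team (sigma i) ->
  forall q : nat, sorted_profile D i i' up sigma sigma' g q = D g q.
Proof. by move=> tg q; rewrite /sorted_profile (negbTE tg). Qed.

Lemma dominated_cross D i i' sigma sigma' : i' = i.+1 :> nat ->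
    team (sigma i) != team (sigma i') ->
    arrangement_state team sigma = arrangement_state team sigma' ->
    dominated team D sigma sigma' ->
  dominated team D (tperm i i' * sigma)%g (tperm i i' * sigma')%g.
Proof.
move=> ii' tii' arr dom g p pn.
have [p' p'n E] := low_count_cross g ii' tii' pn.
have [-> ->] := E sigma erefl; have [-> _] := E sigma' (esym arr).
exact: dom.
Qed.

Lemma ler_dist_comb (p q a b a' b' A B : R) : 0 <= p -> 0 <= q ->
  `|a - a'| <= A -> `|b - b'| <= B ->
  `|p * a + q * b - (p * a' + q * b')| <= p * A + q * B.
Proof.
move=> p0 q0 aA bB.
rewrite [X in `|X|](_ : _ = p * (a - a') + q * (b - b')); last by ring.
apply: le_trans (ler_normD _ _) _; rewrite !normrM (ger0_norm p0) (ger0_norm q0).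
by apply: lerD; apply: ler_wpM2l.
Qed.

(** Both copies use the same positions and, for team-mates, the same random order. The summed masses
    dominate, in expectation, a quantity that is at least 1 while the copies differ; the factor 2
    bounds the variation of [f]. *)
Lemma gladiator_chain_close t (f : {perm 'I_n} -> R) sigma sigma' D :
    (forall tau, `|f tau| <= 1) -> (forall g q, 0 <= D g q) ->
    arrangement_state team sigma = arrangement_state team sigma' ->
    dominated team D sigma sigma' ->
  `|iter t (chain_op (gladiator_chain team s)) f sigma -
    iter t (chain_op (gladiator_chain team s)) f sigma'| <=
  2 * \sum_g mass_after s (team g) t (arrangement_state team sigma) (D g).
Proof.
move=> f1; elim: t sigma sigma' D => [|t IHt] sigma sigma' D D0 arr dom /=.
  have [->|ne] := eqVneq sigma sigma'.
    rewrite subrr normr0 mulr_ge0 // sumr_ge0 // => g _.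
    by apply: sumr_ge0 => q _; apply: D0.
  have [g [p pn low]] : exists g, exists2 p, (p <= n)%N &
      low_count team g sigma p != low_count team g sigma' p.
    apply: contrapT => H; move/eqP: ne; apply; apply: (@low_count_separates _ _ team).
    move=> g p pn; apply/eqP/negPn/negP => low; apply: H.
    by exists g; exists p.
  have Dg : 1 <= D g (rank_of (team g) (arrangement_state team sigma) p).
    apply: le_trans (dom g p pn); move: low; rewrite neq_ltn => /orP[] lt.
      rewrite distrC; apply: le_trans (ler_norm _).
      by rewrite -natrB ?ler1n ?subn_gt0 // ltnW.
    apply: le_trans (ler_norm _).
    by rewrite -natrB ?ler1n ?subn_gt0 // ltnW.
  have : 1 <= \sum_g mass_after s (team g) 0 (arrangement_state team sigma) (D g).
    rewrite (bigD1 g) //= -[leLHS]addr0 lerD //; last first.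
      by apply: sumr_ge0 => h _; apply: sumr_ge0 => q _; apply: D0.
    have rm : (rank_of (team g) (arrangement_state team sigma) p <
               #|team_set team (team g)|.+1)%N.
      rewrite ltnS -(rank_of_full (team g) (arrangement_state team sigma)).
      exact: prefix_count_homo.
    rewrite /mass_after /= /profile_mass (bigD1 (Ordinal rm)) //= -[leLHS]addr0 lerD //.
    by apply: sumr_ge0 => q _; apply: D0.
  have := ler_normB (f sigma) (f sigma'); have := f1 sigma; have := f1 sigma'.
  by lra.
rewrite !gladiator_chain_op /mass_after /= -adjacent_mean_sum -adjacent_meanZ.
apply: adjacent_mean_dist_le => i i' ii'.
have teamE q : team (sigma' q) = team (sigma q).
  by move: arr => /(congr1 (fun x => val x q)); rewrite !arrangement_stateE.
rewrite !teamE !arrangement_stateE.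
under eq_bigr do rewrite -/(mass_after s _ t).
have [tii'|tii'] := eqVneq (team (sigma i)) (team (sigma i')); last first.
  have [p0 p1] := andP (forward_prob_bounds s_gt0 (team (sigma i)) (team (sigma i'))).
  rewrite big_split /= -!mulr_sumr mulrDr mulrCA [in leRHS](mulrCA 2 (1 - _)).
  apply: ler_dist_comb; rewrite ?subr_ge0 //; last exact: IHt.
  rewrite -arrangement_state_tperm; apply: IHt => //.
    by rewrite !arrangement_state_tperm arr.
  exact: dominated_cross.
have tii'2 : team (sigma' i) = team (sigma' i') by rewrite !teamE.
rewrite -tii' forward_prob_same // (_ : 1 - 2^-1 = 2^-1); last by field.
have IHsort up : `|iter t (chain_op (gladiator_chain team s)) f (sort_pair i i' up sigma) -
      iter t (chain_op (gladiator_chain team s)) f (sort_pair i i' up sigma')| <=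
    2 * \sum_g mass_after s (team g) t (arrangement_state team sigma)
      (sorted_profile D i i' up sigma sigma' g).
  rewrite -(sort_pair_arrangement up tii'); apply: IHt.
  - by move=> g q; rewrite /sorted_profile; case: (_ && _).
  - by rewrite !sort_pair_arrangement.
  - exact: dominated_sort_pair.
(* A fair choice between exchanging and staying is a fair choice between the two orders, in either
   copy. *)
have split_sort (F : {perm 'I_n} -> R) tau : 2^-1 * F (tperm i i' * tau)%g + 2^-1 * F tau =
    2^-1 * F (sort_pair i i' true tau) + 2^-1 * F (sort_pair i i' false tau).
  by rewrite /sort_pair; case: (tau i < tau i')%N; rewrite /= // addrC.
rewrite !split_sort.
have half0 : 0 <= 2^-1 :> R by rewrite invr_ge0 ler0n.
apply: le_trans (ler_dist_comb half0 half0 (IHsort true) (IHsort false)) _.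
rewrite ![2^-1 * (2 * _)]mulrCA -mulrDr ler_wpM2l //.
rewrite !mulr_sumr -big_split /=; apply: ler_sum => g _.
case: eqP => [tg|/eqP tg].
  by apply: mass_after_sublinear => //; apply: sorted_profile_average.
apply: mass_after_sublinear => // q.
by rewrite !sorted_profile_other 1?eq_sym //; lra.
Qed.

End Labels.

(** * The stationary distribution of the particle system *)

Lemma prefix_count_flat n (b : pred 'I_n) (p p' : nat) : (p <= p')%N ->
    (forall q : 'I_n, (p <= q < p')%N -> ~~ b q) ->
  prefix_count b p' = prefix_count b p.
Proof.
move=> pp' nb; rewrite /prefix_count [LHS]big_mkcond [RHS]big_mkcond /=.
apply: eq_bigr => q _; have [qp|pq] := ltnP q p; first by rewrite (leq_trans qp).
by case: ltnP => // qp'; have := nb q; rewrite pq qp' => /(_ isT)/negbTE ->.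
Qed.

Lemma prefix_count_gap_le n (b1 b2 : pred 'I_n) (p p' : nat) :
    (forall q, b1 q -> b2 q) -> (p <= p')%N ->
  (prefix_count b1 p' + prefix_count b2 p <= prefix_count b1 p + prefix_count b2 p')%N.
Proof.
move=> b12 pp'.
have split_b2 q : prefix_count b2 q =
    (prefix_count b1 q + prefix_count (fun z => b2 z && ~~ b1 z) q)%N.
  rewrite /prefix_count -big_split /=; apply: eq_bigr => z _.
  by have := b12 z; case: (b1 z) => // [->|_] //; case: (b2 z).
have := prefix_count_homo (fun z => b2 z && ~~ b1 z) pp'.
by rewrite (split_b2 p) (split_b2 p'); lia.
Qed.

Section Stationary.
Variables (R : realType) (n k : nat) (team : 'I_n -> 'I_k) (s : 'I_k -> R).
Hypotheses (n2 : (2 <= n)%N) (s_gt0 : forall j, 0 < s j).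
Local Notation X := (particle_state team).
Local Notation P := (linear_particle_system team s).
Implicit Types (x y : X) (i p q : 'I_n).

(** Positions start at 0. Exponents starting at 1 would multiply all weights by the same factor, the
    number of particles of each type being fixed. *)
Definition weight x : R := \prod_p s (val x p) ^+ p.

Lemma weight_gt0 x : 0 < weight x.
Proof. by apply: prodr_gt0 => p _; rewrite exprn_gt0. Qed.

Lemma weight_exchange x p q : p != q ->
  weight (exchange_state x p q) * (s (val x p) ^+ p * s (val x q) ^+ q) =
  weight x * (s (val x q) ^+ p * s (val x p) ^+ q).
Proof.
move=> pq; have qp : q != p by rewrite eq_sym.
rewrite /weight (bigD1 p) //= (bigD1 q) //= [in RHS](bigD1 p) //= [in RHS](bigD1 q) //=.
rewrite !ffunE tpermL tpermR.
rewrite [X in _ * (_ * X) * _ = _](eq_bigr (fun z : 'I_n => s (val x z) ^+ z)).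
  by ring.
by move=> z /andP[zp zq]; rewrite !ffunE tpermD // eq_sym.
Qed.

Lemma weight_exchange_le x p q : (p <= q)%N -> s (val x q) <= s (val x p) ->
  weight x <= weight (exchange_state x p q).
Proof.
move=> pq spq; have [<-|npq] := eqVneq p q.
  rewrite (_ : exchange_state x p p = x) //; apply: val_inj; apply/ffunP => z.
  by rewrite exchange_stateE tperm1 perm1.
have := weight_exchange x npq; have := weight_gt0 x.
have := s_gt0 (val x p); have := s_gt0 (val x q).
move: spq (weight_gt0 (exchange_state x p q)).
set A := s (val x p); set B := s (val x q); set w' := weight (exchange_state _ _ _).
set w := weight x => BA w'0 B0 A0 w0 eqw.
have {eqw} eqw : w' * B ^+ (q - p) = w * A ^+ (q - p).
  have AB0 : A ^+ p * B ^+ p != 0 by rewrite mulf_neq0 ?expf_neq0 ?gt_eqF.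
  apply: (mulfI AB0); move: eqw; rewrite -(subnKC pq) !exprD addKn => eqw.
  transitivity (w' * (A ^+ p * (B ^+ p * B ^+ (q - p)))); first by ring.
  by rewrite eqw; ring.
rewrite -(ler_pM2r (exprn_gt0 (q - p) B0)) eqw ler_pM2l //.
by apply: lerXn2r => //; rewrite nnegrE ltW.
Qed.

(** Detailed balance for each pair of positions: the flow is unchanged by the exchange, an
    involution of the states, so the exchange terms cancel. *)
Lemma weight_invariant (f : X -> R) :
  \sum_x weight x * chain_op P f x = \sum_x weight x * f x.
Proof.
under eq_bigr do rewrite linear_particle_system_op -adjacent_meanZ.
rewrite -adjacent_mean_sum -[RHS](adjacent_mean_cst _ n2).
apply: eq_adjacent_mean => i i' ii'.
pose flow x := (val x i != val x i')%:R *
  (weight x * forward_prob s (val x i) (val x i')).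
have flowE x : flow (exchange_state x i i') = flow x.
  rewrite /flow !exchange_stateE tpermL tpermR eq_sym.
  case: eqP => [_|ne]; rewrite ?mul0r // !mul1r.
  have nii' : i != i' by rewrite -val_eqE /= ii' neq_ltn ltnSn.
  have := weight_exchange x nii'; rewrite ii' !exprS /forward_prob.
  have := s_gt0 (val x i); have := s_gt0 (val x i').
  set A := s (val x i); set B := s (val x i') => B0 A0 eqw.
  have AB : A ^+ i * B ^+ i != 0 by rewrite mulf_neq0 ?expf_neq0 ?gt_eqF.
  apply: (mulfI AB); rewrite [B + A]addrC !mulrA; congr (_ / _).
  transitivity (weight (exchange_state x i i') * (A ^+ i * (B * B ^+ i))); first by ring.
  by rewrite eqw; ring.
have -> : \sum_x weight x * (if val x i == val x i' then f x else
    forward_prob s (val x i) (val x i') * f (exchange_state x i i') +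
    (1 - forward_prob s (val x i) (val x i')) * f x) =
  \sum_x weight x * f x +
    (\sum_x flow x * f (exchange_state x i i') - \sum_x flow x * f x).
  rewrite -sumrB -big_split /=; apply: eq_bigr => x _; rewrite /flow.
  by case: eqP => _ /=; rewrite ?mulr0n ?mulr1n; ring.
have -> : \sum_x flow x * f (exchange_state x i i') = \sum_x flow x * f x.
  have xchK : cancel (fun x => exchange_state x i i') (fun x => exchange_state x i i').
    by move=> x; apply: exchange_stateK.
  rewrite [RHS](reindex_inj (can_inj xchK)) /=.
  by apply: eq_bigr => x _; rewrite flowE.
by rewrite subrr addr0.
Qed.


(** * Adjacency of consecutive particles under the stationary weights *)

Definition meeting_place j r y (z : 'I_n * 'I_n) : bool :=
  [&& z.2 == z.1.+1 :> nat, val y z.1 == j, val y z.2 == j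
    & (rank_of j y z.1).+1 == r].

(** A decoder for [gather_pair]: it undoes the two exchanges from the original positions [p], [p']
    and the meeting place. Hence a gathered state has at most [n ^ 2] sources. *)
Definition separate j r p p' y : X :=
  if [pick z | meeting_place j r y z] is Some z
  then exchange_state (exchange_state y z.2 p') p z.1 else y.

(* The particles of ranks r - 1 and r are brought together between the last
   particle weaker than j that separates them and its right neighbour: both
   exchanges then increase the weight. *)
Lemma gather_pair j r x : (0 < r < #|team_set team j|)%N ->
  exists p p' y, [/\ adjacent_at j r y, separate j r p p' y = x & weight x <= weight y].
Proof.
case: r => // r /= rm.
have [p /eqP xp rp] : exists2 p, val x p == j & rank_of j x p = r.
  by apply: prefix_count_reach; rewrite -/(rank_of j x n) rank_of_full ltnW.
have [p' /eqP xp' rp'] : exists2 p, val x p == j & rank_of j x p = r.+1.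
  by apply: prefix_count_reach; rewrite -/(rank_of j x n) rank_of_full.
have pp' : (p < p')%N.
  rewrite ltnNge; apply/negP => /(prefix_count_homo (fun q => val x q == j)).
  by rewrite -!/(rank_of _ _ _) rp rp' ltnn.
have between q : (p < q < p')%N -> val x q != j.
  move=> /andP[pq qp']; apply/negP => xq.
  have := prefix_count_homo (fun q => val x q == j) pq.
  have := prefix_count_homo (fun q => val x q == j) qp'.
  by rewrite !prefix_countS xq -!/(rank_of _ _ _) rp rp' xp eqxx; lia.
(* [p] itself counts as weak, so a last weak position [q] always exists; its right neighbour may be
   [p']. *)
pose weak q := [&& (p <= q)%N, (q < p')%N & s (val x q) <= s j].
have weak_p : weak p by rewrite /weak leqnn pp' xp lexx.
have [q /and3P[pq qp' xq] qmax] := arg_maxnP (fun q : 'I_n => q : nat) weak_p.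
have qn : (q.+1 < n)%N by apply: leq_ltn_trans qp' (ltn_ord p').
pose q1 := Ordinal qn.
have xq1 : s j <= s (val x q1).
  case: (leP (s j) (s (val x q1))) => // lt; have [e|ne] := eqVneq q1 p'.
    by move: lt; rewrite e xp' ltxx.
  have /qmax : weak q1.
    rewrite /weak (leq_trans pq) //= (ltW lt) andbT ltn_neqAle qp' andbT.
    by rewrite -val_eqE in ne.
  by rewrite /= ltnn.
pose x2 := exchange_state x p q; pose y := exchange_state x2 q1 p'.
have nq : (q != q1) && (q != p') by rewrite -!val_eqE /= !neq_ltn ltnSn qp'.
have x2E (z : 'I_n) : (q < z)%N -> val x2 z = val x z.
  move=> qz; rewrite exchange_stateE tpermD // -val_eqE neq_ltn ?qz //.
  by rewrite (leq_ltn_trans pq).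
have yE (z : 'I_n) : (z <= q)%N -> val y z = val x2 z.
  move=> zq; rewrite exchange_stateE tpermD // -val_eqE neq_ltn /=.
    by rewrite ltnS zq orbT.
  by rewrite (leq_ltn_trans zq) ?orbT.
have yq : val y q = j by rewrite yE // exchange_stateE tpermR xp.
have yq1 : val y q1 = j by rewrite exchange_stateE tpermL x2E.
have rq : rank_of j y q = r.
  rewrite -rp /rank_of (@prefix_count_flat _ _ p) //.
    apply: eq_prefix_count => z zp; rewrite yE ?(ltnW (leq_trans zp pq)) //.
    by rewrite exchange_stateE tpermD // -val_eqE neq_ltn ?zp ?(leq_trans zp pq) orbT.
  move=> z /andP[pz zq]; rewrite yE ?(ltnW zq) // exchange_stateE.
  case: tpermP => [_|zq'|/eqP zp _].
  - by apply: between; rewrite qp' andbT; lia.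
  - by rewrite zq' ltnn in zq.
  - by apply: between; rewrite (ltn_trans zq) // andbT ltn_neqAle pz eq_sym val_eqE zp.
have meet_q : meeting_place j r.+1 y (q, q1).
  by rewrite /meeting_place /= yq yq1 rq !eqxx.
exists p, p', y; split.
- apply/existsP; exists q; apply/existsP; exists q1.
  exact: meet_q.
- rewrite /separate.
  (* The rank determines the meeting place, so the one picked is [(q, q1)]. *)
  case: pickP => [[a a1] /and4P[/= /eqP aa1 ya _ /eqP[ra]]|/(_ (q, q1))]; last first.
    by rewrite meet_q.
  have aq : a = q.
    apply: (@prefix_count_inj _ (fun q => val y q == j)) => //; first by rewrite yq.
    by rewrite -!/(rank_of _ _ _) ra rq.
  have -> : a1 = q1 by apply: val_inj; rewrite /= aa1 aq.
  by rewrite aq /y exchange_stateK exchange_stateK.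
- apply: (@le_trans _ _ (weight x2)).
    by apply: weight_exchange_le => //; rewrite xp.
  by apply: weight_exchange_le => //; rewrite !x2E // xp'.
Qed.

Definition particle_distribution x : R := weight x / \sum_y weight y.

(** Each state is charged to the state of [gather_pair], which is at least as heavy; a state is
    charged at most once per pair of positions, so the adjacent states carry at least [1 / n ^ 2] of
    the weight. *)
Lemma particle_distribution_adjacent j r x0 : (0 < r < #|team_set team j|)%N ->
  is_distribution particle_distribution /\
  (n%:R ^+ 2)^-1 <= \sum_y particle_distribution y * (adjacent_at j r y)%:R.
Proof.
move=> rm; set Z := \sum_y weight y.
have Z0 : 0 < Z.
  rewrite /Z (bigD1 x0) //= ltr_wpDr ?weight_gt0 //.
  by apply: sumr_ge0 => y _; apply/ltW/weight_gt0.
split.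
  split=> [x|]; first by rewrite divr_ge0 ?ltW ?weight_gt0.
  by rewrite -mulr_suml divff ?gt_eqF.
have n20 : 0 < n%:R ^+ 2 :> R by rewrite exprn_gt0 // ltr0n; lia.
rewrite (eq_bigr (fun y => Z^-1 * (weight y * (adjacent_at j r y)%:R))); last first.
  by move=> y _; rewrite /particle_distribution -/Z; ring.
rewrite -mulr_sumr ler_pdivlMl // -ler_pdivlMr ?invr_gt0 // invrK.
set W := \sum_y _ * _.
(* Each [y] and each pair [p], [p'] decode to exactly one [x]. *)
have -> : W * n%:R ^+ 2 =
  \sum_x \sum_p \sum_p' \sum_y
    (x == separate j r p p' y)%:R * (weight y * (adjacent_at j r y)%:R).
  rewrite exchange_big /=; under eq_bigr do rewrite exchange_big /=.
  under eq_bigr do under eq_bigr do rewrite exchange_big /=.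
  under eq_bigr do under eq_bigr do under eq_bigr do rewrite -mulr_suml.
  have one (z : X) : \sum_x (x == z)%:R = 1 :> R.
    by rewrite (bigD1 z) //= eqxx big1 ?addr0 // => y /negbTE ->.
  under eq_bigr do under eq_bigr do under eq_bigr do rewrite one mul1r.
  by rewrite -/W !sumr_const !card_ord -mulrnA -[RHS]mulr_natr natrM expr2.
apply: ler_sum => x _; have [p [p' [y [adj sep le_w]]]] := gather_pair x rm.
apply: le_trans le_w _.
have term_ge0 q q' z : 0 <= (x == separate j r q q' z)%:R *
    (weight z * (adjacent_at j r z)%:R).
  by rewrite !mulr_ge0 ?ler0n // ltW // weight_gt0.
rewrite (bigD1 p) //= (bigD1 p') //= (bigD1 y) //= sep eqxx adj mul1r mulr1.
rewrite -!addrA lerDl !addr_ge0 //.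
- exact: sumr_ge0.
- by apply: sumr_ge0 => q _; exact: sumr_ge0.
- by apply: sumr_ge0 => q _; apply: sumr_ge0 => q' _; exact: sumr_ge0.
Qed.

End Stationary.

(** * Mixing *)

Lemma half_pow_le (R : realType) (a n d : nat) :
  2 ^+ a * n%:R ^+ d * 2^-1 ^+ (a + d * n) <= 1 :> R.
Proof.
rewrite exprVn ler_pdivrMr ?exprn_gt0 // mul1r exprD ler_wpM2l ?exprn_ge0 //.
rewrite -!natrX ler_nat; by case: d => // d; rewrite mulnC expnM leq_exp2r // ltnW // ltn_expl.
Qed.

(** A Bernoulli-type bound, [(1 - gam) ^+ d * (1 + d * gam) <= 1]: since [N * gam >= 1], every [N]
    factors at least halve the product. *)
Lemma pow_one_sub_inv_le (R : realType) (N b : nat) (gam : R) : (0 < N)%N ->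
  N%:R^-1 <= gam <= 1 -> (1 - gam) ^+ (N * b) <= 2^-1 ^+ b.
Proof.
move=> N0 /andP[gamN gam1]; rewrite exprM.
have gam0 : 0 <= gam by rewrite (le_trans _ gamN) // invr_ge0.
apply: lerXn2r; rewrite ?nnegrE ?exprn_ge0 ?subr_ge0 ?invr_ge0 //.
have bern : forall d, (1 - gam) ^+ d * (1 + d%:R * gam) <= 1.
  elim=> [|d IHd]; first by rewrite expr0 mul0r addr0 mulr1.
  apply: le_trans IHd; rewrite exprSr -mulrA ler_wpM2l ?exprn_ge0 ?subr_ge0 //.
  rewrite mulrS; have : 0 <= d%:R * gam * gam by rewrite !mulr_ge0.
  have : 0 <= gam * gam by exact: mulr_ge0.
  by lra.
have N1 : 1 <= N%:R * gam by rewrite -ler_pdivrMl ?ltr0n // mulr1.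
have q0 : 0 <= (1 - gam) ^+ N by rewrite exprn_ge0 // subr_ge0.
have := bern N; have := ler_wpM2l q0 N1; lra.
Qed.

Section GladiatorMixing.
Variables (R : realType) (n k : nat) (team : 'I_n -> 'I_k) (s : 'I_k -> R).
Hypotheses (n2 : (2 <= n)%N) (s_gt0 : forall j, 0 < s j).
Local Notation X := (particle_state team).
Local Notation P := (linear_particle_system team s).
Local Notation G := (gladiator_chain team s).
Implicit Types (f h : {perm 'I_n} -> R) (sigma tau : {perm 'I_n}).

Lemma gladiator_chain_dist_le t f h B sigma :
  (forall tau, `|f tau - h tau| <= B) ->
  `|iter t (chain_op G) f sigma - iter t (chain_op G) h sigma| <= B.
Proof.
move=> fhB; elim: t sigma => //= t IHt sigma; rewrite !gladiator_chain_op.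
rewrite -[leRHS](adjacent_mean_cst B n2); apply: adjacent_mean_dist_le => i i' _.
have [p0 p1] := andP (forward_prob_bounds s_gt0 (team (sigma i)) (team (sigma i'))).
rewrite -subr_ge0 in p1.
by apply: le_trans (ler_dist_comb p0 p1 (IHt _) (IHt _)) _; lra.
Qed.

Lemma gladiator_chain_norm_le t f B sigma : (forall tau, `|f tau| <= B) ->
  `|iter t (chain_op G) f sigma| <= B.
Proof.
move=> fB; have := @gladiator_chain_dist_le t f (fun=> 0) B sigma.
rewrite [X in _ - X]chain_op_iter big1 ?subr0 => [|tau _]; last by rewrite mulr0.
by apply=> tau; rewrite subr0.
Qed.

Definition parabola (g : 'I_n) (q : nat) : R :=
  (q * (#|team_set team (team g)| - q))%:R.

Lemma concave_parabola g : concave_profile #|team_set team (team g)| (parabola g).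
Proof.
rewrite /parabola; split=> [||q qm|r rm].
- by rewrite mul0n.
- by rewrite subnn muln0.
- exact: ler0n.
- rewrite -natrD -natrM ler_nat; case: r rm => // r /andP[_ rm] /=.
  move: rm; set m := #|_| => rm; have -> : (m - r = (m - r.+2).+2)%N by lia.
  have -> : (m - r.+1 = (m - r.+2).+1)%N by lia.
  lia.
Qed.

Lemma parabola_mass_le g :
  profile_mass #|team_set team (team g)| (parabola g) <= 2 * n%:R ^+ 3.
Proof.
set m := #|_|; have mn : (m <= n)%N by rewrite -[leqRHS]card_ord max_card.
apply: (@le_trans _ _ (\sum_(i < m.+1) (n * n)%:R)).
  apply: ler_sum => i _; rewrite ler_nat leq_mul //; have := ltn_ord i; lia.
rewrite sumr_const card_ord -mulrnA -natrX -natrM ler_nat !expnS expn0.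
nia.
Qed.

(** With [K] team-mates up to [g], a low count lies between 0 and [c] and between [K + c - m] and
    [K]. Two of them differ by at most the minimum of [c] and [m - c], hence by at most
    [c * (m - c)]. *)
Lemma dominated_parabola sigma sigma' :
  arrangement_state team sigma = arrangement_state team sigma' ->
  dominated team parabola sigma sigma'.
Proof.
move=> arr g p pn; rewrite /parabola.
set m := #|_|; set c := rank_of _ _ _.
have bounds tau : arrangement_state team tau = arrangement_state team sigma ->
    [/\ (low_count team g tau p <= c)%N,
        (low_count team g tau p <= #|[set h | teammate_upto team g h]|)%N &
        (#|[set h | teammate_upto team g h]| + c <= low_count team g tau p + m)%N].
  move=> tauE; have full : low_count team g tau n = #|[set h | teammate_upto team g h]|.
    rewrite /low_count prefix_count_full -[RHS](card_preimset _ (perm_inj (s := tau))).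
    by apply: eq_card => q; rewrite !inE.
  have low_type q : teammate_upto team g (tau q) ->
      val (arrangement_state team sigma) q == team g.
    by rewrite -tauE arrangement_stateE => /andP[].
  rewrite -full; split.
  - exact: prefix_count_le low_type.
  - exact: prefix_count_homo.
  - have := prefix_count_gap_le low_type pn.
    by rewrite -!/(rank_of _ _ _) rank_of_full.
have [l1 l2 l3] := bounds sigma erefl; have [l1' l2' l3'] := bounds sigma' (esym arr).
move: l1 l2 l3 l1' l2' l3'.
set l := low_count _ _ _ _; set l' := low_count _ _ _ _ => l1 l2 l3 l1' l2' l3'.
have [e|e] := leqP l l'.
  rewrite distrC ger0_norm ?subr_ge0 ?ler_nat // -natrB // ler_nat.
  by nia.
rewrite ger0_norm ?subr_ge0 ?ler_nat 1?ltnW // -natrB 1?ltnW // ler_nat.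
by nia.
Qed.


(** The first [L] steps mix the arrangement, the others scramble the order inside the teams. As an
    operator the second stage acts first, turning [f] into nearly a function of the arrangement. *)
Lemma gladiator_mixed t0 piG piX :
    (0 < t0)%N -> stationary G piG -> stationary P piX -> mixed P piX t0 ->
  let L := ((2 + 2 * n) * t0)%N in
  mixed G piG (L + 4 * n ^ 5 * (5 + 4 * n) * L.+1).
Proof.
move=> t00 GpiG [piXd _] mixP; set c := (2 + 2 * n)%N => L; set b := (4 * n ^ 5 * _)%N.
have n0 : 0 < n%:R :> R by rewrite ltr0n; lia.
(* After [c] halvings, twice the error is at most half of the stationary adjacency probability
   [1 / n ^ 2], which leaves [rho]. *)
have c_small : 4 * n%:R ^+ 2 * 2^-1 ^+ c <= 1 :> R.
  by have := half_pow_le R 2 n 2; rewrite [2 ^+ 2](_ : _ = 4) //; ring.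
have contr := mixed_contraction piXd (linear_particle_system_row_sum s n2) mixP.
pose rho : R := (2 * n%:R ^+ 2)^-1.
have meet j r x : (0 < r < #|team_set team j|)%N ->
    rho <= iter L (chain_op P) (fun y => (adjacent_at j r y)%:R) x.
  move=> rm; have [pd p_adj] := particle_distribution_adjacent n2 s_gt0 x rm.
  have [|z Hz] := contr (fun y => (adjacent_at j r y)%:R) _ c.
    by move=> y; case: adjacent_at; rewrite ?normr1 ?normr0.
  have inv := @invariant_iter _ _ P (@particle_distribution R n k team s) L
    (fun y => (adjacent_at j r y)%:R).
  (* The stationary mean and the value at [x] both lie within [2^-1 ^+ c] of [z]. *)
  have := distribution_mean_close pd Hz; rewrite inv; last first.
    move=> f; rewrite /particle_distribution.
    under eq_bigr do rewrite mulrAC; under [RHS]eq_bigr do rewrite mulrAC.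
    by rewrite -!mulr_suml weight_invariant.
  have := Hz x; rewrite !ler_distl => /andP[h1 _] /andP[_ h2].
  have e : 2 * 2^-1 ^+ c <= rho.
    by rewrite /rho -[leRHS]div1r ler_pdivlMr ?mulr_gt0 ?exprn_gt0 //; lra.
  have rhoE : (n%:R ^+ 2)^-1 = 2 * rho by rewrite /rho; field; lra.
  by lra.
have decay sigma g : mass_after s (team g) (b * L.+1) (arrangement_state team sigma)
    (parabola g) <= 2^-1 ^+ (5 + 4 * n) * (2 * n%:R ^+ 3).
  have m0 : (0 < #|team_set team (team g)|)%N.
    by apply/card_gt0P; exists g; rewrite inE.
  have mn : (#|team_set team (team g)| <= n)%N by rewrite -[leqRHS]card_ord max_card.
  have rho01 : 0 <= rho <= 1.
    rewrite /rho invr_ge0 mulr_ge0 ?exprn_ge0 ?ler0n //=.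
    rewrite invf_le1 ?mulr_gt0 ?exprn_gt0 //.
    have : 1 <= n%:R ^+ 2 :> R by rewrite exprn_ege1 // ler1n; lia.
    by lra.
  apply: le_trans (mass_after_decay n2 s_gt0 m0 rho01 (meet (team g)) b _
    (concave_parabola g)) _.
  set gam := _ / (2 * _); have [rho0 rho1] := andP rho01.
  have n1 : 0 < n.-1%:R :> R by rewrite ltr0n; lia.
  have m2 : 1 <= #|team_set team (team g)|%:R ^+ 2 :> R.
    by rewrite exprn_ege1 // ler1n.
  (* The factors [n], [2 * n ^ 2] (from [rho]) and [2 * n ^ 2] (from the team size) multiply to
     [4 * n ^ 5], the number of blocks per halving. *)
  have gam_bounds : (4 * n ^ 5)%:R^-1 <= gam <= 1.
    apply/andP; split.
      rewrite (_ : _^-1 = n%:R^-1 * rho / (2 * n%:R ^+ 2)); last first.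
        by rewrite /rho natrM natrX; field; lra.
      rewrite /gam; apply: ler_pM.
      - by rewrite mulr_ge0 // invr_ge0 ltW.
      - by rewrite invr_ge0 mulr_ge0 // exprn_ge0 // ltW.
      - by rewrite ler_wpM2r // lef_pV2 ?posrE // ler_nat leq_pred.
      - have mn2 : #|team_set team (team g)|%:R ^+ 2 <= n%:R ^+ 2 :> R.
          by apply: lerXn2r; rewrite ?nnegrE // ler_nat.
        by rewrite lef_pV2 ?posrE; lra.
    rewrite /gam ler_pdivrMr; last by lra.
    have : n.-1%:R^-1 * rho <= 1.
      by rewrite mulr_ile1 ?invr_ge0 ?ler0n // invf_le1 // ler1n; lia.
    by lra.
  have mass0 : 0 <= profile_mass #|team_set team (team g)| (parabola g).
    by apply: sumr_ge0 => q _; apply: ler0n.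
  apply: ler_pM; rewrite ?parabola_mass_le // ?exprn_ge0 ?subr_ge0 ?(andP gam_bounds).2 //.
  by apply: pow_one_sub_inv_le => //; rewrite muln_gt0 expn_gt0; lia.
have labels f sigma sigma' : (forall tau, `|f tau| <= 1) ->
    arrangement_state team sigma = arrangement_state team sigma' ->
  `|iter (b * L.+1) (chain_op G) f sigma - iter (b * L.+1) (chain_op G) f sigma'| <= 8^-1.
  move=> f1 arr.
  have par0 g q : 0 <= parabola g q by apply: ler0n.
  apply: le_trans (gladiator_chain_close n2 s_gt0 _ f1 par0 arr (dominated_parabola arr)) _.
  apply: (@le_trans _ _ (2 * \sum_(g < n) 2^-1 ^+ (5 + 4 * n) * (2 * n%:R ^+ 3))).
    by rewrite ler_wpM2l //; apply: ler_sum => g _; apply: decay.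
  rewrite sumr_const card_ord -[_ *+ n]mulr_natl.
  (* The bound is [4 * n ^ 4 * q], and [32 * n ^ 4 * q <= 1]. *)
  have := half_pow_le R 5 n 4; set q := 2^-1 ^+ _ => small.
  by rewrite (_ : _ * _ = 2 ^+ 5 * n%:R ^+ 4 * q / 8); [lra | field].
apply: (mixed_of_oscillation GpiG) => f f1 sigma sigma'.
rewrite !(iterD L); set F := iter (b * L.+1) _ f.
(* Any representative will do, as [labels] makes [F] nearly constant on each arrangement. The
   default 0 is not reached at the arrangement of a permutation. *)
pose Fbar (x : X) : R :=
  if [pick tau | arrangement_state team tau == x] is Some tau then F tau else 0.
have F1 tau : `|F tau| <= 1 by apply: gladiator_chain_norm_le.
have Fbar1 x : `|Fbar x| <= 1 by rewrite /Fbar; case: pickP => // _; rewrite normr0.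
have F_Fbar tau : `|F tau - (Fbar \o arrangement_state team) tau| <= 8^-1.
  rewrite /= /Fbar; case: pickP => [tau' /eqP e|/(_ tau)]; last by rewrite eqxx.
  exact: labels.
have [z Hz] := contr Fbar Fbar1 c.
have := gladiator_chain_dist_le L sigma F_Fbar.
have := gladiator_chain_dist_le L sigma' F_Fbar.
rewrite !gladiator_chain_lump //.
have := Hz (arrangement_state team sigma); have := Hz (arrangement_state team sigma').
(* Two errors of 1/8 and two of 1/16 add up to 3/8, below the allowed 1/2. *)
have small : 2^-1 ^+ c <= 16^-1 :> R.
  have : 4 <= n%:R ^+ 2 :> R by rewrite -natrX ler_nat; nia.
  by have : 0 <= 2^-1 ^+ c :> R; [exact: exprn_ge0|move: c_small; nra].
rewrite -/L !ler_distl => /andP[? ?] /andP[? ?] /andP[? ?] /andP[? ?].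
by apply/andP; split; lra.
Qed.

End GladiatorMixing.

Theorem theorem1 (R : realType) :
  exists2 C : R, 0 < C &
    forall (n k : nat) (team : 'I_n -> 'I_k) (s : 'I_k -> R)
           (piG : {perm 'I_n} -> R) (piX : particle_state team -> R),
      (2 <= n)%N ->
      (forall j, 0 < s j) ->
      stationary (gladiator_chain team s) piG ->
      stationary (linear_particle_system team s) piX ->
      (mixing_time (gladiator_chain team s) piG
        <= (C * n%:R ^+ 8)%:E
             * mixing_time (linear_particle_system team s) piX)%E.
Proof.
(* 115 = 3 + 112: the two stages take at most [3 * n * t0] and [112 * n ^ 7 * t0] steps. *)
exists 115%:R => // n k team s piG piX n2 s0 GpiG PpiX.
have n8 : 0 < 115%:R * n%:R ^+ 8 :> R.
  by rewrite mulr_gt0 ?exprn_gt0 // ltr0n; lia.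
(* If the particle system never mixes, its mixing time is infinite and the bound is trivial. *)
case: (pselect (exists t, `[< (0 < t)%N /\ mixed (linear_particle_system team s) piX t >])).
  move=> ex; case: (ex_minnP ex) => t0 /asboolP[t00 mixP] t0min.
  apply: (@le_trans _ _ (115%:R * n%:R ^+ 8 * t0%:R)%:E); last first.
    rewrite EFinM; apply: lee_wpmul2l; first by rewrite lee_fin ltW.
    rewrite /mixing_time; apply: le_ereal_inf_tmp => _ [t [tpos mixt] <-].
    by rewrite lee_fin ler_nat; apply: t0min; apply/asboolP.
  pose L := ((2 + 2 * n) * t0)%N; pose T := (L + 4 * n ^ 5 * (5 + 4 * n) * L.+1)%N.
  have mixG : mixed (gladiator_chain team s) piG T.
    exact: gladiator_mixed PpiX mixP.
  apply: (@le_trans _ _ (T%:R)%:E).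
    apply: ereal_inf_lbound; exists T => //; split=> //.
    by rewrite addn_gt0 /L muln_gt0 t00.
  rewrite lee_fin -natrX -!natrM ler_nat /T.
  have Ln : (L <= 3 * (n * t0))%N by rewrite /L; nia.
  (* The extra step is absorbed because [t0] is positive. *)
  have L1n : (L.+1 <= 4 * (n * t0))%N by rewrite /L; nia.
  have b7 : (5 + 4 * n <= 7 * n)%N by lia.
  have n68 : (n * t0 <= n ^ 8 * t0)%N
    by rewrite leq_mul2r -{1}(expn1 n) leq_pexp2l ?orbT // ltnW.
  have n78 : (n ^ 7 * t0 <= n ^ 8 * t0)%N.
    by rewrite leq_mul2r leq_pexp2l ?orbT // ltnW.
  have := leq_mul (leq_mul (leqnn (4 * n ^ 5)%N) b7) L1n.
  rewrite (_ : (4 * n ^ 5 * (7 * n) * (4 * (n * t0)) = 112 * (n ^ 7 * t0))%N).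
    by lia.
  by rewrite !expnS; ring.
move=> nex; rewrite [X in (_ <= _ * X)%E](_ : _ = +oo%E).
  by rewrite gt0_muley ?lte_fin // leey.
rewrite /mixing_time (_ : [set _ | _ in _]%classic = set0) ?ereal_inf0 //.
rewrite -subset0 => y [t tP _]; apply: nex; exists t; exact/asboolP.
Qed.
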